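(* Let $C$ be an unextended command, $P,Q$ assertions, $\Gamma$ a resource context and $A\subseteq\mathbf{Var}$. If $\Gamma\vdash_A\{P\}C\{Q\}$ is derivable, then for every $(s,h)\in\mathcal{S}$ with $s,h\models P$, every $n\ge0$, and every pair of disjoint sets $L,D$ with $L\cup D=Res(\Gamma)$, the predicate $\mathit{Safe}_n(C,s,h,(\emptyset,L,D),\Gamma,Q,A)$ holds.
   Context: States and assertions. $\mathbf{Var}$ variables, $\mathbf{Val}$ values (integers and $null$), $\mathbf{Loc}\subseteq\mathbb{N}$; stores $s:\mathbf{Var}\to\mathbf{Val}$, heaps finite partial $h:\mathbf{Loc}\rightharpoonup\mathbf{Val}$; $\mathcal{S}$ the set of pairs $(s,h)$. Assertions: separation-logic assertions (boolean expressions, $\neg,\wedge,\forall$, $\texttt{emp}$, $e\mapsto e'_1,\dots,e'_n$, $\ast$) with standard satisfaction $s,h\models P$; $FV$ free variables; $h\bot g$ disjoint domains, $h\uplus g$ union. Precise assertion: for every $(s,h)$ at most one subheap $h'$ of $h$ with $s,h'\models P$. $\mathbf{Res}$ resource names disjoint from $\mathbf{Var}$. Resource context $\Gamma=r_1(X_1):R_1,\dots,r_n(X_n):R_n$ with distinct $r_i$, $X_i\subseteq\mathbf{Var}$, precise $R_i$, $FV(R_i)\subseteq X_i$; $Res(\Gamma)$, $PV(r_i)=X_i$, $PV(\Gamma)=\bigcup X_i$, $\Gamma(r_i)=R_i$, $\circledast_{r\in D}\Gamma(r)$ separating conjunction over $D$ ($\texttt{emp}$ if empty); $\Gamma[r'/r]$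 renaming. Commands. Basic $c::=x:=e\mid x:=[e]\mid[e]:=e'\mid x:=\mathsf{cons}(e_1,..,e_n)\mid\mathsf{dispose}(e)$ with standard semantics $[c](s,h)$ (a pair or $\mathsf{abort}$ on access outside $dom(h)$). Unextended: $\mathsf{skip}$, $c$, $C_1;C_2$, $\mathsf{if}\ B\ \mathsf{then}\ C_1\ \mathsf{else}\ C_2$, $\mathsf{while}\ B\ \mathsf{do}\ C$, $\mathsf{resource}\ r\ \mathsf{in}\ C$, $\mathsf{with}\ r\ \mathsf{when}\ B\ \mathsf{do}\ C$, $C_1\|C_2$; extended also $\mathsf{within}\ r\ \mathsf{do}\ C$. $mod(C)$: variables $x$ with $x:=e$, $x:=[e]$ or $x:=\mathsf{cons}(\dots)$ in $C$. $Res(C)$: resource names in $C$; $C[r'/r]$ renaming. $X$ is auxiliary for $C$ if every occurrence of $x\in X$ in $C$ is inside an assignment to a variable in $X$; $C\setminus X$ replaces those assignments by $\mathsf{skip}$. $Locked$: $Locked(C_1;C_2)=Locked(C_1)$, $Locked(C_1\|C_2)=Locked(C_1)\cup Locked(C_2)$, $Locked(\mathsf{resource}\ r\ \mathsf{in}\ C)=Locked(C)\setminus\{r\}$, $Locked(\mathsf{within}\ r\ \mathsf{do}\ C)=Locked(C)\cup\{r\}$, else $\emptyset$. Operational semantics. Resource configuration $\rho=(O,L,D)$: pairwise disjoint subsets of $\mathbf{Res}$; $r\in\rho$ iff $r\in O\cup L\cup D$; $\rho\setminus\{r\}$ componentwise. Program transitions $\to_p$: (S1) $\mathsf{skip};C_2,\sigma\to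 C_2,\sigma$; (S2) $C_1;C_2$ steps via $C_1$; (LP) $\mathsf{while}\ B\ \mathsf{do}\ C\to\mathsf{if}\ B\ \mathsf{then}\ (C;\mathsf{while}\ B\ \mathsf{do}\ C)\ \mathsf{else}\ \mathsf{skip}$; (IF1/IF2) by $s(B)$; (P1/P2) a component of $\|$ steps; (P3) $\mathsf{skip}\|\mathsf{skip}\to\mathsf{skip}$; (R0) $\mathsf{resource}\ r\ \mathsf{in}\ \mathsf{skip}\to\mathsf{skip}$ if $r\notin\rho$; (R1) if $r\notin\rho=(O,L,D)$, $r\in Locked(C)$, $C,(s,h,(O\cup\{r\},L,D))\to_pC',(s',h',\rho')$ then $\mathsf{resource}\ r\ \mathsf{in}\ C,(s,h,\rho)\to_p\mathsf{resource}\ r\ \mathsf{in}\ C',(s',h',\rho'\setminus\{r\})$; (R2) same with $r\notin Locked(C)$ and $(O,L,D\cup\{r\})$; (W0) $\mathsf{with}\ r\ \mathsf{when}\ B\ \mathsf{do}\ C,(s,h,(O,L,D\cup\{r\}))\to_p\mathsf{within}\ r\ \mathsf{do}\ C,(s,h,(O\cup\{r\},L,D))$ if $s(B)=\texttt{true}$; (W1) if $r\in O$ and $C,(s,h,(O\setminus\{r\},L,D))\to_pC',(s',h',(O',L',D'))$ then $\mathsf{within}\ r\ \mathsf{do}\ C,(s,h,(O,L,D))\to_p\mathsf{within}\ r\ \mathsf{do}\ C',(s',h',(O'\cup\{r\},L',D'))$; (W2) $\mathsf{within}\ r\ \mathsf{do}\ \mathsf{skip},(s,h,(O\cup\{r\},L,D))\to_p\mathsf{skip},(s,h,(O,L,D\cup\{r\}))$;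 (BCT) $c,(s,h,\rho)\to_p\mathsf{skip},(s',h',\rho)$ if $[c](s,h)=(s',h')$. Abort: (RA) $\mathsf{resource}\ r$ with $r\in\rho$; (WA) $\mathsf{with}\ r$ with $r\notin\rho$; (RA1)/(RA2) body aborts under the configuration used in (R1)/(R2); (BCA) $[c](s,h)=\mathsf{abort}$; (SA) first component of $;$ aborts; (WA1) $\mathsf{within}\ r\ \mathsf{do}\ C,(s,h,\rho)$ if $C,(s,h,\rho\setminus\{r\})$ aborts; (WA2) $\mathsf{within}\ r$ with $r\notin O$; (PA1/PA2) a component of $\|$ aborts. Environment and safety. $(s,h,(O,L,D))\stackrel{A}{\leftrightsquigarrow}(s',h,(O,L',D'))$ iff $s(x)=s'(x)$ for $x\in A$ and $L'\cup D'=L\cup D$. With $A'=A\cup\bigcup_{r\in Locked(C)}PV(r)$: if $(s,h,\rho)\stackrel{A'}{\leftrightsquigarrow}(s',h,\rho')$, $s,h_G\models\circledast_{r\in D}\Gamma(r)$ and $s',h'_G\models\circledast_{r\in D'}\Gamma(r)$, then $C,(s,h\uplus h_G,\rho)\xrightarrow{A,\Gamma}_eC,(s',h\uplus h'_G,\rho')$. $\xrightarrow{A,\Gamma}=\to_p\cup\xrightarrow{A,\Gamma}_e$. $chng(C)$: variables $x$ such that the next transition of $C$ can execute $x:=e$, $x:=[e]$ or $x:=\mathsf{cons}(\dots)$. $\mathit{Safe}_0$ always holds; $\mathit{Safe}_{n+1}(C,s,h,\rho,\Gamma,Q,A)$, $\rho=(O,L,D)$, iff (i) $C=\mathsf{skip}\Rightarrow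 s,h\models Q$; (ii) $C,(s,h,\rho)\not\to_p\mathsf{abort}$; (iii) $chng(C)\cap\bigcup_{r\in L\cup D}PV(r)=\emptyset$; (iv) for every $h_G\bot h$ with $s,h_G\models\circledast_{r\in D}\Gamma(r)$ and every $C,(s,h\uplus h_G,\rho)\xrightarrow{A,\Gamma}C',(s',\hat h,\rho')$, $\rho'=(O',L',D')$, there are $h',h'_G$ with $\hat h=h'\uplus h'_G$, $s',h'_G\models\circledast_{r\in D'}\Gamma(r)$ and $\mathit{Safe}_n(C',s',h',\rho',\Gamma,Q,A)$. Proof system. $\Gamma\vdash_A\{P\}C\{Q\}$ is well-formed if $FV(P,Q)\subseteq A$ and $FV(C)\subseteq A\cup PV(\Gamma)$. Derivable specifications are well-formed ones generated by: (SKP) $\Gamma\vdash_A\{P\}\mathsf{skip}\{P\}$; (BC) $\vdash^{SL}\{P\}c\{Q\}$ (standard sequential separation logic) and $mod(c)\cap PV(\Gamma)=\emptyset$ give $\Gamma\vdash_A\{P\}c\{Q\}$; (SEQ) $\Gamma\vdash_{A_1}\{P_1\}C_1\{P_2\}$, $\Gamma\vdash_{A_2}\{P_2\}C_2\{P_3\}$ give $\Gamma\vdash_{A_1\cup A_2}\{P_1\}C_1;C_2\{P_3\}$; (FRA) $\Gamma\vdash_A\{P\}C\{Q\}$, $mod(C)\cap FV(R)=\emptyset$ give $\Gamma\vdash_{A\cup FV(R)}\{P\ast R\}C\{Q\ast R\}$; (LP) $\Gamma\vdash_A\{P\wedge B\}C\{P\}$ gives $\Gamma\vdash_A\{P\}\mathsf{while}\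 B\ \mathsf{do}\ C\{P\wedge\neg B\}$; (CONJ) $\Gamma\vdash_{A_1}\{P_1\}C\{Q_1\}$, $\Gamma\vdash_{A_2}\{P_2\}C\{Q_2\}$ give $\Gamma\vdash_{A_1\cup A_2}\{P_1\wedge P_2\}C\{Q_1\wedge Q_2\}$; (IF) $\Gamma\vdash_{A_1}\{P\wedge B\}C_1\{Q\}$, $\Gamma\vdash_{A_2}\{P\wedge\neg B\}C_2\{Q\}$ give $\Gamma\vdash_{A_1\cup A_2}\{P\}\mathsf{if}\ B\ \mathsf{then}\ C_1\ \mathsf{else}\ C_2\{Q\}$; (CONS) $\Gamma\vdash_A\{P\}C\{Q\}$, $\models P'\Rightarrow P$, $\models Q\Rightarrow Q'$, $A\subseteq A'$ give $\Gamma\vdash_{A'}\{P'\}C\{Q'\}$; (AUX) $\Gamma\vdash_{A\cup X}\{P\}C\{Q\}$, $X\cap FV(P,Q)=\emptyset$, $X\cap PV(\Gamma)=\emptyset$, $X$ auxiliary for $C$ give $\Gamma\vdash_A\{P\}C\setminus X\{Q\}$; (REN) $\Gamma[r'/r]\vdash_A\{P\}C[r'/r]\{Q\}$, $r'\notin Res(C)\cup Res(\Gamma)$ give $\Gamma\vdash_A\{P\}C\{Q\}$; (PAR) $\Gamma\vdash_{A_1}\{P_1\}C_1\{Q_1\}$, $\Gamma\vdash_{A_2}\{P_2\}C_2\{Q_2\}$, $mod(C_1)\cap A_2=mod(C_2)\cap A_1=\emptyset$ give $\Gamma\vdash_{A_1\cup A_2}\{P_1\ast P_2\}C_1\|C_2\{Q_1\ast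 Q_2\}$; (CR) $\Gamma\vdash_{A\cup X}\{(P\wedge B)\ast R\}C\{Q\ast R\}$ gives $\Gamma,r(X):R\vdash_A\{P\}\mathsf{with}\ r\ \mathsf{when}\ B\ \mathsf{do}\ C\{Q\}$; (RES) $\Gamma,r(X):R\vdash_A\{P\}C\{Q\}$ gives $\Gamma\vdash_{A\cup X}\{P\ast R\}\mathsf{resource}\ r\ \mathsf{in}\ C\{Q\ast R\}$. *)

(* Defs.v *)
From mathcomp Require Import all_boot all_order all_algebra.
From mathcomp Require Import finmap boolp classical_sets.

Set Implicit Arguments.
Unset Strict Implicit.
Unset Printing Implicit Defensive.

Local Open Scope classical_set_scope.

(* [Some z] is the integer z and [None] is null. *)
Definition value : Type := option int.

Section Syntax.

(* Program variables and resource names have different types, hence are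
   disjoint. *)
Context (Var Res : eqType).

Inductive expr :=
  | EVar of Var
  | EInt of int
  | ENull
  | EAdd of expr & expr
  | ESub of expr & expr
  | EMul of expr & expr.

Inductive bexpr :=
  | BTrue
  | BEq of expr & expr
  | BLt of expr & expr
  | BNot of bexpr
  | BAnd of bexpr & bexpr.

(* [APts e e1 es] is  e |-> e1, es : the list of contents is nonempty. *)
Inductive assn :=
  | ABool of bexpr
  | ANot of assn
  | AAnd of assn & assn
  | AAll of Var & assn
  | AEmp
  | APts of expr & expr & seq expr
  | AStar of assn & assn.

Definition AOr (P Q : assn) : assn := ANot (AAnd (ANot P) (ANot Q)).
Definition AEx (x : Var) (P : assn) : assn := ANot (AAll x (ANot P)).

(* [BCons x e es] is  x := cons(e, es) . *)
Inductive bcmd :=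
  | BAssign of Var & expr
  | BLookup of Var & expr
  | BMutate of expr & expr
  | BCons of Var & expr & seq expr
  | BDispose of expr.

Inductive cmd :=
  | Skip
  | Basic of bcmd
  | Seq of cmd & cmd
  | If of bexpr & cmd & cmd
  | While of bexpr & cmd
  | Resource of Res & cmd
  | With of Res & bexpr & cmd
  | Within of Res & cmd
  | Par of cmd & cmd.

Fixpoint unextended (C : cmd) : bool :=
  match C with
  | Skip | Basic _ => true
  | Seq C1 C2 | If _ C1 C2 | Par C1 C2 => unextended C1 && unextended C2
  | While _ C1 | Resource _ C1 | With _ _ C1 => unextended C1
  | Within _ _ => false
  end.

Fixpoint fv_expr (e : expr) : set Var :=
  match e with
  | EVar x => [set x]
  | EInt _ | ENull => set0
  | EAdd e1 e2 | ESub e1 e2 | EMul e1 e2 => fv_expr e1 `|` fv_expr e2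
  end.

Definition fv_exprs (es : seq expr) : set Var :=
  foldr (fun e F => fv_expr e `|` F) set0 es.

Fixpoint fv_bexpr (B : bexpr) : set Var :=
  match B with
  | BTrue => set0
  | BEq e1 e2 | BLt e1 e2 => fv_expr e1 `|` fv_expr e2
  | BNot B1 => fv_bexpr B1
  | BAnd B1 B2 => fv_bexpr B1 `|` fv_bexpr B2
  end.

Fixpoint fv_assn (P : assn) : set Var :=
  match P with
  | ABool B => fv_bexpr B
  | ANot P1 => fv_assn P1
  | AAnd P1 P2 | AStar P1 P2 => fv_assn P1 `|` fv_assn P2
  | AAll x P1 => fv_assn P1 `\ x
  | AEmp => set0
  | APts e e1 es => fv_exprs [:: e, e1 & es]
  end.

Definition fv_bcmd (c : bcmd) : set Var :=
  match c with
  | BAssign x e | BLookup x e => x |` fv_expr e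
  | BMutate e e' => fv_expr e `|` fv_expr e'
  | BCons x e es => x |` fv_exprs (e :: es)
  | BDispose e => fv_expr e
  end.

Fixpoint fv_cmd (C : cmd) : set Var :=
  match C with
  | Skip => set0
  | Basic c => fv_bcmd c
  | Seq C1 C2 | Par C1 C2 => fv_cmd C1 `|` fv_cmd C2
  | If B C1 C2 => fv_bexpr B `|` (fv_cmd C1 `|` fv_cmd C2)
  | While B C1 | With _ B C1 => fv_bexpr B `|` fv_cmd C1
  | Resource _ C1 | Within _ C1 => fv_cmd C1
  end.

Definition mod_bcmd (c : bcmd) : set Var :=
  match c with
  | BAssign x _ | BLookup x _ | BCons x _ _ => [set x]
  | BMutate _ _ | BDispose _ => set0
  end.

Fixpoint mod_cmd (C : cmd) : set Var :=
  match C with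
  | Skip => set0
  | Basic c => mod_bcmd c
  | Seq C1 C2 | If _ C1 C2 | Par C1 C2 => mod_cmd C1 `|` mod_cmd C2
  | While _ C1 | Resource _ C1 | With _ _ C1 | Within _ C1 => mod_cmd C1
  end.

(* Unlike [mod_cmd], only the basic commands that can be executed by the very
   next transition count. *)
Fixpoint chng (C : cmd) : set Var :=
  match C with
  | Basic c => mod_bcmd c
  | Seq C1 _ => chng C1
  | Par C1 C2 => chng C1 `|` chng C2
  | Resource _ C1 | Within _ C1 => chng C1
  | Skip | If _ _ _ | While _ _ | With _ _ _ => set0
  end.

Fixpoint locked (C : cmd) : set Res :=
  match C with
  | Seq C1 _ => locked C1
  | Par C1 C2 => locked C1 `|` locked C2
  | Resource r C1 => locked C1 `\ r
  | Within r C1 => r |` locked C1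
  | Skip | Basic _ | If _ _ _ | While _ _ | With _ _ _ => set0
  end.

(* All resource names occurring in C, including those bound by [Resource]. *)
Fixpoint res_cmd (C : cmd) : set Res :=
  match C with
  | Skip | Basic _ => set0
  | Seq C1 C2 | If _ C1 C2 | Par C1 C2 => res_cmd C1 `|` res_cmd C2
  | While _ C1 => res_cmd C1
  | Resource r C1 | With r _ C1 | Within r C1 => r |` res_cmd C1
  end.

Definition ren_res (r r' q : Res) : Res := if q == r then r' else q.

(* C[r'/r] replaces every occurrence of r, binding occurrences included:
   since [resource r in C] aborts when r is already declared, the name of a
   local resource matters and the renaming has to be consistent. *)
Fixpoint ren_cmd (r r' : Res) (C : cmd) : cmd :=
  match C with
  | Skip => Skip
  | Basic c => Basic c
  | Seq C1 C2 => Seq (ren_cmd r r' C1) (ren_cmd r r' C2)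
  | If B C1 C2 => If B (ren_cmd r r' C1) (ren_cmd r r' C2)
  | While B C1 => While B (ren_cmd r r' C1)
  | Resource q C1 => Resource (ren_res r r' q) (ren_cmd r r' C1)
  | With q B C1 => With (ren_res r r' q) B (ren_cmd r r' C1)
  | Within q C1 => Within (ren_res r r' q) (ren_cmd r r' C1)
  | Par C1 C2 => Par (ren_cmd r r' C1) (ren_cmd r r' C2)
  end.

(* The assignments are the commands x := e only: lookups and allocations touch
   the heap (erasing an allocation would not even be sound), so a variable of X
   may not occur in them. *)
Fixpoint auxiliary (X : set Var) (C : cmd) : Prop :=
  match C with
  | Skip => True
  | Basic (BAssign x e) => X x \/ fv_expr e `&` X = set0
  | Basic c => fv_bcmd c `&` X = set0
  | Seq C1 C2 | Par C1 C2 => auxiliary X C1 /\ auxiliary X C2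
  | If B C1 C2 =>
      [/\ fv_bexpr B `&` X = set0, auxiliary X C1 & auxiliary X C2]
  | While B C1 | With _ B C1 => fv_bexpr B `&` X = set0 /\ auxiliary X C1
  | Resource _ C1 | Within _ C1 => auxiliary X C1
  end.

Fixpoint erase (X : set Var) (C : cmd) : cmd :=
  match C with
  | Skip => Skip
  | Basic (BAssign x e) => if x \in X then Skip else Basic (BAssign x e)
  | Basic c => Basic c
  | Seq C1 C2 => Seq (erase X C1) (erase X C2)
  | If B C1 C2 => If B (erase X C1) (erase X C2)
  | While B C1 => While B (erase X C1)
  | Resource r C1 => Resource r (erase X C1)
  | With r B C1 => With r B (erase X C1)
  | Within r C1 => Within r (erase X C1)
  | Par C1 C2 => Par (erase X C1) (erase X C2)
  end.

(* [subst_expr m x e] is e[m/x]. *)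
Fixpoint subst_expr (m x : Var) (e : expr) : expr :=
  match e with
  | EVar y => EVar (if y == x then m else y)
  | EInt z => EInt z
  | ENull => ENull
  | EAdd e1 e2 => EAdd (subst_expr m x e1) (subst_expr m x e2)
  | ESub e1 e2 => ESub (subst_expr m x e1) (subst_expr m x e2)
  | EMul e1 e2 => EMul (subst_expr m x e1) (subst_expr m x e2)
  end.

(* [RDecl r X R] is r(X) : R. *)
Record rdecl := RDecl { rname : Res; rvars : set Var; rinv : assn }.

Definition ctx := seq rdecl.

Implicit Types (G : ctx) (r : Res).

Definition res_ctx G : set Res := [set r | r \in map rname G].

Definition lookup G r : option rdecl := ohead [seq d <- G | rname d == r].

Definition pv G r : set Var := if lookup G r is Some d then rvars d else set0.

Definition pv_ctx G : set Var := \bigcup_(r in res_ctx G) pv G r.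

Definition ren_ctx r r' G : ctx :=
  [seq RDecl (ren_res r r' (rname d)) (rvars d) (rinv d) | d <- G].

Definition inv_star G (D : set Res) : assn :=
  \big[AStar/AEmp]_(d <- G | rname d \in D) rinv d.

End Syntax.

Arguments ENull {Var}.
Arguments EInt {Var}.
Arguments BTrue {Var}.
Arguments AEmp {Var}.
Arguments Skip {Var Res}.
Arguments Basic {Var Res}.

Section Semantics.

(* The set of locations is an arbitrary subset of the natural numbers. *)
Context (Var Res : eqType) (Loc : pred nat).

Definition store := Var -> value.

Definition heap := {fmap {l : nat | Loc l} -> value}.

Implicit Types (s : store) (h : heap) (l : {l : nat | Loc l}) (n i : nat).

Definition update s (x : Var) (v : value) : store :=
  fun y => if y == x then v else s y.

Definition addr n : value := Some (Posz n).

Definition heap_disj h1 h2 : bool := [disjoint domf h1 & domf h2]%fset.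

Definition heap_union h1 h2 : heap := (h1 + h2)%fset.

Definition int_op (f : int -> int -> int) (v w : value) : value :=
  if (v, w) is (Some a, Some b) then Some (f a b) else None.

(* Arithmetic on null yields null, and null is not comparable by <. *)
Fixpoint eval s (e : expr Var) : value :=
  match e with
  | EVar x => s x
  | EInt z => Some z
  | ENull => None
  | EAdd e1 e2 => int_op (fun a b => (a + b)%R) (eval s e1) (eval s e2)
  | ESub e1 e2 => int_op (fun a b => (a - b)%R) (eval s e1) (eval s e2)
  | EMul e1 e2 => int_op (fun a b => (a * b)%R) (eval s e1) (eval s e2)
  end.

Fixpoint beval s (B : bexpr Var) : bool :=
  match B with
  | BTrue => true
  | BEq e1 e2 => eval s e1 == eval s e2
  | BLt e1 e2 =>
      if (eval s e1, eval s e2) is (Some a, Some b) then (a < b)%R else false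
  | BNot B1 => ~~ beval s B1
  | BAnd B1 B2 => beval s B1 && beval s B2
  end.

(* h consists exactly of the cells n, ..., n + size vs - 1, with contents vs. *)
Definition is_block h n (vs : seq value) : Prop :=
  (forall i, i < size vs -> Loc (n + i)) /\
  (forall l, h.[? l]%fmap = if n <= sval l then onth vs (sval l - n) else None).

Fixpoint sat s h (P : assn Var) {struct P} : Prop :=
  match P with
  | ABool B => beval s B
  | ANot P1 => ~ sat s h P1
  | AAnd P1 P2 => sat s h P1 /\ sat s h P2
  | AAll x P1 => forall v : value, sat (update s x v) h P1
  | AEmp => h = [fmap]%fmap
  | APts e e1 es =>
      exists2 n, eval s e = addr n & is_block h n (map (eval s) (e1 :: es))
  | AStar P1 P2 =>
      exists h1 h2,
        [/\ heap_disj h1 h2, h = heap_union h1 h2, sat s h1 P1 & sat s h2 P2]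
  end.

Definition entails (P Q : assn Var) : Prop :=
  forall s h, sat s h P -> sat s h Q.

Definition subheap h' h : Prop :=
  exists2 g, heap_disj h' g & h = heap_union h' g.

Definition precise (P : assn Var) : Prop :=
  forall s h h1 h2, subheap h1 h -> subheap h2 h ->
    sat s h1 P -> sat s h2 P -> h1 = h2.

Definition ctx_ok (G : ctx Var Res) : Prop :=
  uniq (map (@rname Var Res) G) /\
  (forall r d, lookup G r = Some d ->
     precise (rinv d) /\ fv_assn (rinv d) `<=` rvars d).

(* Allocation is nondeterministic, so [c](s,h) is given as a relation. *)
Inductive bexec : bcmd Var -> store -> heap -> store -> heap -> Prop :=
  | bexec_assign x e s h :
      bexec (BAssign x e) s h (update s x (eval s e)) h
  | bexec_lookup x e s h l v :
      eval s e = addr (sval l) -> h.[? l]%fmap = Some v ->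
      bexec (BLookup x e) s h (update s x v) h
  | bexec_mutate e e' s h l :
      eval s e = addr (sval l) -> l \in domf h ->
      bexec (BMutate e e') s h s h.[l <- eval s e']%fmap
  | bexec_cons x e es s h n g :
      is_block g n (map (eval s) (e :: es)) -> heap_disj h g ->
      bexec (BCons x e es) s h (update s x (addr n)) (heap_union h g)
  | bexec_dispose e s h l :
      eval s e = addr (sval l) -> l \in domf h ->
      bexec (BDispose e) s h s h.[~ l]%fmap.

Definition dangling s h (e : expr Var) : Prop :=
  forall l, eval s e = addr (sval l) -> l \notin domf h.

Definition babort (c : bcmd Var) s h : Prop :=
  match c with
  | BAssign _ _ | BCons _ _ _ => False
  | BLookup _ e | BMutate e _ | BDispose e => dangling s h e
  end.

(* The resource configuration (O, L, D). *)
Record rconf := RConf { rO : set Res; rL : set Res; rD : set Res }.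

Definition rconf_ok (p : rconf) : Prop :=
  [/\ rO p `&` rL p = set0, rO p `&` rD p = set0 & rL p `&` rD p = set0].

Definition rconf_dom (p : rconf) : set Res := rO p `|` rL p `|` rD p.

Definition rconf_del (p : rconf) (r : Res) : rconf :=
  RConf (rO p `\ r) (rL p `\ r) (rD p `\ r).

Implicit Types (C : cmd Var Res) (p : rconf) (O L D : set Res).

(* In [pstep_W0] and [pstep_W2] the components of a configuration being
   disjoint, a configuration of the form (O, L, D `|` {r}) is written as
   (O, L, D) with r in D, and its D is then D `\ r. *)
Inductive pstep :
    cmd Var Res -> store -> heap -> rconf ->
    cmd Var Res -> store -> heap -> rconf -> Prop :=
  | pstep_S1 C2 s h p : pstep (Seq Skip C2) s h p C2 s h p
  | pstep_S2 C1 C2 s h p C1' s' h' p' :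
      pstep C1 s h p C1' s' h' p' ->
      pstep (Seq C1 C2) s h p (Seq C1' C2) s' h' p'
  | pstep_LP B C s h p :
      pstep (While B C) s h p (If B (Seq C (While B C)) Skip) s h p
  | pstep_IF1 B C1 C2 s h p :
      beval s B -> pstep (If B C1 C2) s h p C1 s h p
  | pstep_IF2 B C1 C2 s h p :
      ~~ beval s B -> pstep (If B C1 C2) s h p C2 s h p
  | pstep_P1 C1 C2 s h p C1' s' h' p' :
      pstep C1 s h p C1' s' h' p' ->
      pstep (Par C1 C2) s h p (Par C1' C2) s' h' p'
  | pstep_P2 C1 C2 s h p C2' s' h' p' :
      pstep C2 s h p C2' s' h' p' ->
      pstep (Par C1 C2) s h p (Par C1 C2') s' h' p'
  | pstep_P3 s h p : pstep (Par Skip Skip) s h p Skip s h p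
  | pstep_R0 r s h p :
      ~ rconf_dom p r -> pstep (Resource r Skip) s h p Skip s h p
  | pstep_R1 r C s h O L D C' s' h' p' :
      ~ rconf_dom (RConf O L D) r -> locked C r ->
      pstep C s h (RConf (r |` O) L D) C' s' h' p' ->
      pstep (Resource r C) s h (RConf O L D)
            (Resource r C') s' h' (rconf_del p' r)
  | pstep_R2 r C s h O L D C' s' h' p' :
      ~ rconf_dom (RConf O L D) r -> ~ locked C r ->
      pstep C s h (RConf O L (r |` D)) C' s' h' p' ->
      pstep (Resource r C) s h (RConf O L D)
            (Resource r C') s' h' (rconf_del p' r)
  | pstep_W0 r B C s h O L D :
      D r -> beval s B ->
      pstep (With r B C) s h (RConf O L D)
            (Within r C) s h (RConf (r |` O) L (D `\ r))
  | pstep_W1 r C s h O L D C' s' h' O' L' D' :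
      O r ->
      pstep C s h (RConf (O `\ r) L D) C' s' h' (RConf O' L' D') ->
      pstep (Within r C) s h (RConf O L D)
            (Within r C') s' h' (RConf (r |` O') L' D')
  | pstep_W2 r s h O L D :
      O r ->
      pstep (Within r Skip) s h (RConf O L D)
            Skip s h (RConf (O `\ r) L (r |` D))
  | pstep_BCT c s h p s' h' :
      bexec c s h s' h' -> pstep (Basic c) s h p Skip s' h' p.

Inductive pabort : cmd Var Res -> store -> heap -> rconf -> Prop :=
  | pabort_RA r C s h p :
      rconf_dom p r -> pabort (Resource r C) s h p
  | pabort_WA r B C s h p :
      ~ rconf_dom p r -> pabort (With r B C) s h p
  | pabort_RA1 r C s h O L D :
      ~ rconf_dom (RConf O L D) r -> locked C r ->
      pabort C s h (RConf (r |` O) L D) ->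
      pabort (Resource r C) s h (RConf O L D)
  | pabort_RA2 r C s h O L D :
      ~ rconf_dom (RConf O L D) r -> ~ locked C r ->
      pabort C s h (RConf O L (r |` D)) ->
      pabort (Resource r C) s h (RConf O L D)
  | pabort_BCA c s h p :
      babort c s h -> pabort (Basic c) s h p
  | pabort_SA C1 C2 s h p :
      pabort C1 s h p -> pabort (Seq C1 C2) s h p
  | pabort_WA1 r C s h p :
      pabort C s h (rconf_del p r) -> pabort (Within r C) s h p
  | pabort_WA2 r C s h p :
      ~ rO p r -> pabort (Within r C) s h p
  | pabort_PA1 C1 C2 s h p :
      pabort C1 s h p -> pabort (Par C1 C2) s h p
  | pabort_PA2 C1 C2 s h p :
      pabort C2 s h p -> pabort (Par C1 C2) s h p.

Definition env_rel (A : set Var) s p s' p' : Prop :=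
  [/\ rconf_ok p, rconf_ok p',
      (forall x, A x -> s x = s' x),
      rO p' = rO p &
      rL p' `|` rD p' = rL p `|` rD p].

Inductive estep (A : set Var) (G : ctx Var Res) :
    cmd Var Res -> store -> heap -> rconf ->
    cmd Var Res -> store -> heap -> rconf -> Prop :=
  | EStep C s h hG p s' hG' p' :
      env_rel (A `|` \bigcup_(r in locked C) pv G r) s p s' p' ->
      heap_disj h hG -> heap_disj h hG' ->
      sat s hG (inv_star G (rD p)) ->
      sat s' hG' (inv_star G (rD p')) ->
      estep A G C s (heap_union h hG) p C s' (heap_union h hG') p'.

Definition step (A : set Var) (G : ctx Var Res) C s h p C' s' h' p' : Prop :=
  pstep C s h p C' s' h' p' \/ estep A G C s h p C' s' h' p'.

Fixpoint safe (n : nat) C s h p (G : ctx Var Res) (Q : assn Var)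
    (A : set Var) : Prop :=
  if n is n'.+1 then
    [/\ (C = Skip -> sat s h Q),
        ~ pabort C s h p,
        chng C `&` \bigcup_(r in rL p `|` rD p) pv G r = set0 &
        forall hG, heap_disj h hG -> sat s hG (inv_star G (rD p)) ->
        forall C' s' k p', step A G C s (heap_union h hG) p C' s' k p' ->
        exists h' hG',
          [/\ heap_disj h' hG', k = heap_union h' hG',
              sat s' hG' (inv_star G (rD p')) &
              safe n' C' s' h' p' G Q A]]
  else True.

End Semantics.

Section ProofSystem.

Context (Var Res : eqType) (Loc : pred nat).

Implicit Types (x y m n : Var) (e : expr Var) (c : bcmd Var).

Local Notation "x =v y" := (ABool (BEq (EVar x) (EVar y))) (at level 70).
Local Notation "x =e e" := (ABool (BEq (EVar x) e)) (at level 70).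

(* Sequential separation logic for the basic commands: the small axioms of
   O'Hearn, Reynolds and Yang, closed under the structural rules. *)
Inductive sl_derivable : assn Var -> bcmd Var -> assn Var -> Prop :=
  | SL_assign x m e :
      x != m ->
      sl_derivable (AAnd (x =v m) AEmp) (BAssign x e)
                   (AAnd (x =e subst_expr m x e) AEmp)
  | SL_lookup x m n e :
      uniq [:: x; m; n] ->
      sl_derivable (AAnd (APts e (EVar n) [::]) (x =v m)) (BLookup x e)
                   (AAnd (x =v n) (APts (subst_expr m x e) (EVar n) [::]))
  | SL_mutate y e e' :
      ~ fv_expr e y ->
      sl_derivable (AEx y (APts e (EVar y) [::])) (BMutate e e')
                   (APts e e' [::])
  | SL_cons x m e es :
      x != m ->
      sl_derivable (AAnd (x =v m) AEmp) (BCons x e es)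
                   (APts (EVar x) (subst_expr m x e) (map (subst_expr m x) es))
  | SL_dispose y e :
      ~ fv_expr e y ->
      sl_derivable (AEx y (APts e (EVar y) [::])) (BDispose e) AEmp
  | SL_frame P Q R c :
      sl_derivable P c Q ->
      mod_bcmd c `&` fv_assn R = set0 ->
      sl_derivable (AStar P R) c (AStar Q R)
  | SL_conseq P P' Q Q' c :
      sl_derivable P c Q -> entails Loc P' P -> entails Loc Q Q' ->
      sl_derivable P' c Q'
  | SL_conj P1 P2 Q1 Q2 c :
      sl_derivable P1 c Q1 -> sl_derivable P2 c Q2 ->
      sl_derivable (AAnd P1 P2) c (AAnd Q1 Q2)
  | SL_disj P1 P2 Q1 Q2 c :
      sl_derivable P1 c Q1 -> sl_derivable P2 c Q2 ->
      sl_derivable (AOr P1 P2) c (AOr Q1 Q2)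
  | SL_ex x P Q c :
      sl_derivable P c Q -> ~ fv_bcmd c x ->
      sl_derivable (AEx x P) c (AEx x Q).

Implicit Types (G : ctx Var Res) (A X : set Var) (P Q R : assn Var)
  (B : bexpr Var) (C : cmd Var Res) (r : Res).

Definition wf_spec G A P C Q : Prop :=
  [/\ ctx_ok Loc G,
      fv_assn P `|` fv_assn Q `<=` A &
      fv_cmd C `<=` A `|` pv_ctx G].

(* Every derived specification is required to be well-formed.  Resource
   contexts are unordered: in CR and RES the declaration of r may be anywhere
   in the list. *)
Inductive derivable :
    ctx Var Res -> set Var -> assn Var -> cmd Var Res -> assn Var -> Prop :=
  | D_SKP G A P :
      wf_spec G A P Skip P ->
      derivable G A P Skip P
  | D_BC G A P c Q :
      wf_spec G A P (Basic c) Q ->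
      sl_derivable P c Q ->
      mod_bcmd c `&` pv_ctx G = set0 ->
      derivable G A P (Basic c) Q
  | D_SEQ G A1 A2 P1 P2 P3 C1 C2 :
      wf_spec G (A1 `|` A2) P1 (Seq C1 C2) P3 ->
      derivable G A1 P1 C1 P2 ->
      derivable G A2 P2 C2 P3 ->
      derivable G (A1 `|` A2) P1 (Seq C1 C2) P3
  | D_FRA G A P C Q R :
      wf_spec G (A `|` fv_assn R) (AStar P R) C (AStar Q R) ->
      derivable G A P C Q ->
      mod_cmd C `&` fv_assn R = set0 ->
      derivable G (A `|` fv_assn R) (AStar P R) C (AStar Q R)
  | D_LP G A P B C :
      wf_spec G A P (While B C) (AAnd P (ANot (ABool B))) ->
      derivable G A (AAnd P (ABool B)) C P ->
      derivable G A P (While B C) (AAnd P (ANot (ABool B)))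
  | D_CONJ G A1 A2 P1 P2 Q1 Q2 C :
      wf_spec G (A1 `|` A2) (AAnd P1 P2) C (AAnd Q1 Q2) ->
      derivable G A1 P1 C Q1 ->
      derivable G A2 P2 C Q2 ->
      derivable G (A1 `|` A2) (AAnd P1 P2) C (AAnd Q1 Q2)
  | D_IF G A1 A2 P Q B C1 C2 :
      wf_spec G (A1 `|` A2) P (If B C1 C2) Q ->
      derivable G A1 (AAnd P (ABool B)) C1 Q ->
      derivable G A2 (AAnd P (ANot (ABool B))) C2 Q ->
      derivable G (A1 `|` A2) P (If B C1 C2) Q
  | D_CONS G A A' P P' Q Q' C :
      wf_spec G A' P' C Q' ->
      derivable G A P C Q ->
      entails Loc P' P -> entails Loc Q Q' -> A `<=` A' ->
      derivable G A' P' C Q'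
  | D_AUX G A X P C Q :
      wf_spec G A P (erase X C) Q ->
      derivable G (A `|` X) P C Q ->
      X `&` (fv_assn P `|` fv_assn Q) = set0 ->
      X `&` pv_ctx G = set0 ->
      auxiliary X C ->
      derivable G A P (erase X C) Q
  | D_REN G A P C Q r r' :
      wf_spec G A P C Q ->
      derivable (ren_ctx r r' G) A P (ren_cmd r r' C) Q ->
      ~ (res_cmd C `|` res_ctx G) r' ->
      derivable G A P C Q
  | D_PAR G A1 A2 P1 P2 Q1 Q2 C1 C2 :
      wf_spec G (A1 `|` A2) (AStar P1 P2) (Par C1 C2) (AStar Q1 Q2) ->
      derivable G A1 P1 C1 Q1 ->
      derivable G A2 P2 C2 Q2 ->
      mod_cmd C1 `&` A2 = set0 ->
      mod_cmd C2 `&` A1 = set0 ->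
      derivable G (A1 `|` A2) (AStar P1 P2) (Par C1 C2) (AStar Q1 Q2)
  | D_CR G1 G2 A X P Q R B C r :
      wf_spec (G1 ++ RDecl r X R :: G2) A P (With r B C) Q ->
      derivable (G1 ++ G2) (A `|` X) (AStar (AAnd P (ABool B)) R) C
                (AStar Q R) ->
      derivable (G1 ++ RDecl r X R :: G2) A P (With r B C) Q
  | D_RES G1 G2 A X P Q R C r :
      wf_spec (G1 ++ G2) (A `|` X) (AStar P R) (Resource r C) (AStar Q R) ->
      derivable (G1 ++ RDecl r X R :: G2) A P C Q ->
      derivable (G1 ++ G2) (A `|` X) (AStar P R) (Resource r C) (AStar Q R).

End ProofSystem.

(* Main.v *)
(* The rules preserve safety at every n, for all configurations reachable from
   (set0, L, D): there O is exactly Locked(C), and the components of a parallel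
   command hold disjoint sets of resources.  Since the invariants are precise,
   a heap splits in at most one way into a private part and the invariants of
   the available resources, so that environment transitions leave the private
   heap unchanged and the conjunction rule holds.  In a parallel command, the
   resources held by one component are seen by the other as members of L, and
   a program transition of one is an environment transition of the other.  The
   renaming rule holds because the semantics is equivariant under a swap of two
   resource names.  For auxiliary variables, the erased program is simulated by
   the original one, which first executes the assignments that erasure made
   disappear; these extra steps are affordable because the original program is
   safe for every n. *)

From mathcomp Require Import all_boot finmap boolp classical_sets.
Require Import Defs.

Set Implicit Arguments.
Unset Strict Implicit.
Unset Printing Implicit Defensive.

Local Open Scope classical_set_scope.

(** * Heaps and assertions *)

Section Heaps.
Context (Loc : pred nat).
Implicit Types (h g : heap Loc) (l : {l : nat | Loc l}).

(** Precision has a further use besides the conjunction rule. The heaps that [safe] promises after a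
    transition are chosen separately for every index, so being safe at all indices does not by
    itself give one successor that is safe at all indices. Uniqueness of the split supplies it, and
    the treatment of auxiliary variables depends on this. That rule meets a second obstacle. Clause
    (i) asks for the postcondition only of [Skip], whereas an erased command may be [Skip] while the
    original still has an assignment to perform. Performing it requires a shared heap that satisfies
    the invariants of the available resources. Every transition provides one, but at the start none
    need exist; the postcondition is then obtained in a configuration where no resource is
    available. *)

Lemma fnd_union h1 h2 l :
  (heap_union h1 h2).[? l]%fmap =
  if h2.[? l]%fmap is Some v then Some v else h1.[? l]%fmap.
Proof.
rewrite /heap_union fnd_cat.
by rewrite -fndSome; case: (h2.[? l]%fmap).
Qed.

(** Stated cell by cell, so that [heap_cells] can instantiate every disjointness hypothesis at one
    location and finish by cases on the values found there. *)
Lemma heap_disjP h1 h2 :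
  reflect (forall l, h1.[? l]%fmap = None \/ h2.[? l]%fmap = None)
          (heap_disj h1 h2).
Proof.
apply: (iffP idP) => [/fdisjointP H l|H]; last apply/fdisjointP => l.
  case E: (h1.[? l]%fmap) => [v|]; [right|by left].
  by apply/not_fnd/H; rewrite -fndSome E.
move=> lh1; case: (H l) => E; last by apply/negP; rewrite -fndSome E.
by move: lh1; rewrite -fndSome E.
Qed.

Lemma disj_fnd h1 h2 l v :
  heap_disj h1 h2 -> h1.[? l]%fmap = Some v -> h2.[? l]%fmap = None.
Proof. by move=> /heap_disjP/(_ l) []->. Qed.

Lemma heap_ext h1 h2 : (forall l, h1.[? l]%fmap = h2.[? l]%fmap) -> h1 = h2.
Proof. by move=> H; apply/fmapP. Qed.

End Heaps.

(* Heap identities and disjointness are checked cell by cell. *)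
Ltac heap_cells l :=
  rewrite ?fnd_union ?fnd_fmap0;
  repeat match goal with
  | H : is_true (heap_disj _ _) |- _ =>
      move/heap_disjP/(_ l): H; rewrite ?fnd_union ?fnd_fmap0
  | H : @eq (heap _) _ _ |- _ =>
      move/(congr1 (fun h => fnd h l)): H; rewrite ?fnd_union ?fnd_fmap0
  end;
  intros;
  repeat (match goal with
  | H : Some _ = None \/ Some _ = None |- _ => destruct H; discriminate
  | H : Some _ = None |- _ => discriminate H
  | H : None = Some _ |- _ => discriminate H
  | H : context [fnd ?h l] |- _ => destruct (fnd h l)
  | |- context [fnd ?h l] => destruct (fnd h l)
  end; cbv iota beta in * );
  try (intuition congruence).

Ltac heaps :=
  match goal with
  | |- is_true (heap_disj _ _) =>
      let l := fresh "l" in apply/heap_disjP => l; heap_cells l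
  | |- _ = _ => let l := fresh "l" in apply: heap_ext => l; heap_cells l
  end.

Lemma set0_disj (T : Type) (X Y : set T) :
  X `&` Y = set0 <-> forall x, X x -> Y x -> False.
Proof.
split=> [XY x Xx Yx|XY].
  by have : (X `&` Y) x; [|rewrite XY].
by apply/seteqP; split=> x // [/XY].
Qed.

Lemma heap_unionC (Loc : pred nat) (h1 h2 : heap Loc) :
  heap_disj h1 h2 -> heap_union h1 h2 = heap_union h2 h1.
Proof. by move=> d; heaps. Qed.

Lemma heap_disjC (Loc : pred nat) (h1 h2 : heap Loc) :
  heap_disj h1 h2 = heap_disj h2 h1.
Proof. by apply/idP/idP => d; heaps. Qed.

(** * Coincidence lemmas, locality of basic commands, soundness of sequential separation logic *)

Section Satisfaction.
Context (Var : eqType) (Loc : pred nat).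
Implicit Types (s : store Var) (h : heap Loc) (e : expr Var) (B : bexpr Var)
  (P Q R : assn Var) (c : bcmd Var) (x m : Var).

Lemma eval_agree s s' e :
  (forall x, fv_expr e x -> s x = s' x) -> eval s e = eval s' e.
Proof.
elim: e => //= [x|e1 IH1 e2 IH2|e1 IH1 e2 IH2|e1 IH1 e2 IH2] E; first exact: E.
all: by rewrite (IH1 (fun x ex => E x (or_introl ex)))
                (IH2 (fun x ex => E x (or_intror ex))).
Qed.

Lemma map_eval_agree s s' (es : seq (expr Var)) :
  (forall x, fv_exprs es x -> s x = s' x) ->
  map (eval s) es = map (eval s') es.
Proof.
elim: es => //= e es IH E; rewrite (@eval_agree s s' e); last first.
  by move=> x ex; apply: E; left.
by rewrite IH // => x ex; apply: E; right.
Qed.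

Lemma beval_agree s s' B :
  (forall x, fv_bexpr B x -> s x = s' x) -> beval s B = beval s' B.
Proof.
elim: B => //= [e1 e2|e1 e2|B IH|B1 IH1 B2 IH2] E.
- rewrite (@eval_agree s s' e1) ?(@eval_agree s s' e2) // => x ex;
  by apply: E; first [by left|by right].
- rewrite (@eval_agree s s' e1) ?(@eval_agree s s' e2) // => x ex;
  by apply: E; first [by left|by right].
- by rewrite IH.
- by rewrite IH1 ?IH2 // => x ex; apply: E; first [by left|by right].
Qed.

Lemma sat_agree s s' h P :
  (forall x, fv_assn P x -> s x = s' x) -> sat s h P -> sat s' h P.
Proof.
(* The induction needs an equivalence because [ANot] reverses implications. *)
move=> E; suff: sat s h P <-> sat s' h P by case.
elim: P s s' h E => /= [B|P IH|P1 IH1 P2 IH2|x P IH||e e1 es|P1 IH1 P2 IH2]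
  s s' h E.
- by rewrite (beval_agree E).
- by have := IH s s' h E; tauto.
- have := IH1 s s' h (fun x ex => E x (or_introl ex)).
  by have := IH2 s s' h (fun x ex => E x (or_intror ex)); tauto.
- suff H v : sat (update s x v) h P <-> sat (update s' x v) h P.
    by split=> H1 v; apply/H/H1.
  apply: IH => y Py; rewrite /update; case: eqP => // yx.
  by apply: E; split.
- by [].
- have -> : eval s e = eval s' e.
    by apply: eval_agree => x ex; apply: E; left.
  have /= [-> ->] // : map (eval s) (e1 :: es) = map (eval s') (e1 :: es).
  by apply: map_eval_agree => x ex; apply: E; right.
- have E1 h1 := IH1 s s' h1 (fun x ex => E x (or_introl ex)).
  have E2 h2 := IH2 s s' h2 (fun x ex => E x (or_intror ex)).
  by split=> -[h1 [h2 [d -> /E1 S1 /E2 S2]]]; exists h1, h2.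
Qed.

Lemma sat_ex s h x P : sat s h (AEx x P) <-> exists v, sat (update s x v) h P.
Proof.
split=> /= [H|[v Pv] H]; last exact: (H v).
by apply: contrapT => N; apply: H => v Pv; apply: N; exists v.
Qed.

Lemma sat_or s h P Q : sat s h (AOr P Q) <-> sat s h P \/ sat s h Q.
Proof. by rewrite /=; have := EM (sat s h P); have := EM (sat s h Q); tauto. Qed.

Lemma sat_star s h1 h2 P Q :
  heap_disj h1 h2 -> sat s h1 P -> sat s h2 Q ->
  sat s (heap_union h1 h2) (AStar P Q).
Proof. by exists h1, h2. Qed.

Lemma update_same s x v : update s x v x = v.
Proof. by rewrite /update eqxx. Qed.

Lemma update_other s x v y : y != x -> update s x v y = s y.
Proof. by rewrite /update => /negbTE->. Qed.

(** Here [m] stores the old value of [x]: it equals [x] before the update and survives it, so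
    reading [m] instead of [x] undoes the update. *)
Lemma eval_subst s x m v e : x != m -> s x = s m ->
  eval (update s x v) (subst_expr m x e) = eval s e.
Proof.
move=> xm sxm; elim: e => //= [y|e1 -> e2 ->|e1 -> e2 ->|e1 -> e2 ->] //.
case: (eqVneq y x) => [->|yx]; last by rewrite update_other.
by rewrite update_other // eq_sym.
Qed.

Lemma map_eval_subst s x m v (es : seq (expr Var)) : x != m -> s x = s m ->
  map (eval (update s x v)) (map (subst_expr m x) es) = map (eval s) es.
Proof. by move=> *; rewrite -map_comp; apply: eq_map => e; exact: eval_subst. Qed.

(** Trades the numerical offsets of [is_block] for a single location of the subtype, the form in
    which lookups in finite maps can be rewritten. *)
Lemma is_block1 h n v : is_block h n [:: v] <->
  exists2 l : {l : nat | Loc l}, sval l = n &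
    forall l', h.[? l']%fmap = if l' == l then Some v else None.
Proof.
split=> [[Ln H]|[l <- H]].
  have Ln0 : Loc n by rewrite -[n]addn0; apply: Ln.
  exists (exist _ n Ln0) => // l'; rewrite H -val_eqE /=.
  case: (ltngtP n (sval l')) => // [lt|->]; last by rewrite subnn ?eqxx.
  by case: (sval l' - n) (subn_gt0 n (sval l')) => [|[]] //; rewrite lt.
split=> [[|//] _|l']; first by rewrite addn0; exact: (svalP l).
rewrite H -val_eqE /=; case: (ltngtP (sval l) (sval l')) => // [lt|->].
  by case: (sval l' - sval l) (subn_gt0 (sval l) (sval l')) => [|[]] //; rewrite lt.
by rewrite subnn.
Qed.

Lemma addr_inj : injective addr.
Proof. by move=> n n' []. Qed.

Lemma bexec_mod c s h s' h' : bexec c s h s' h' ->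
  forall x, ~ mod_bcmd c x -> s' x = s x.
Proof. by case=> //= *; rewrite update_other //; apply/eqP. Qed.

Lemma babort_mono c s h hF :
  babort c s (heap_union h hF) -> babort c s h.
Proof.
have D e : dangling s (heap_union h hF) e -> dangling s h e.
  move=> H l /H; rewrite -!fndSome fnd_union.
  by case: (hF.[? l]%fmap).
by case: c => [x e|x e|e e'|x e es|e] //=; exact: D.
Qed.

Lemma not_dangling s h e l : ~ dangling s h e -> eval s e = addr (sval l) ->
  exists v, h.[? l]%fmap = Some v.
Proof.
move=> nd el; apply: contrapT => N; apply: nd => l' el'.
have <- : l = l' by apply/val_inj/addr_inj; rewrite -el -el'.
by rewrite -fndSome; case E: (h.[? l]%fmap) => [v|] //; case: N; exists v.
Qed.

(** Absence of abort places the accessed location in [h], where [hF] has no cell. An allocated block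
    is disjoint from the whole heap, hence from both parts. *)
Lemma bexec_frame c s h hF s' k :
  bexec c s (heap_union h hF) s' k -> heap_disj h hF -> ~ babort c s h ->
  exists h', [/\ heap_disj h' hF, k = heap_union h' hF & bexec c s h s' h'].
Proof.
move E: (heap_union h hF) => h0 H; case: H E => {s s' h0 k}
  [x e s h0|x e s h0 l v el hl|e e' s h0 l el hl|x e es s h0 n g bg dg
  |e s h0 l el hl] E d na; subst h0.
- by exists h; split=> //; constructor.
- have [w hw] := not_dangling na el.
  exists h; split=> //; apply: bexec_lookup el _.
  by move: hl; rewrite fnd_union (disj_fnd d hw).
- have [w hw] := not_dangling na el.
  exists (h.[l <- eval s e'])%fmap; split.
  + apply/heap_disjP => l'; rewrite fnd_set; case: eqP => [->|_].
      by rewrite (disj_fnd d hw); right.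
    by move/heap_disjP: d.
  + apply: heap_ext => l'; rewrite fnd_union !fnd_set fnd_union.
    case: eqP => // ->.
    by rewrite (disj_fnd d hw).
  + by apply: bexec_mutate; rewrite // -fndSome hw.
- exists (heap_union h g); split; [heaps|heaps|].
  by apply: bexec_cons => //; heaps.
- have [w hw] := not_dangling na el.
  exists (h.[~ l])%fmap; split.
  + apply/heap_disjP => l'; rewrite fnd_rem1; case: eqP => [->|_] /=; first by left.
    by move/heap_disjP: d.
  + apply: heap_ext => l'; rewrite fnd_union !fnd_rem1 fnd_union.
    case: eqP => //= ->.
    by rewrite (disj_fnd d hw).
  + by apply: bexec_dispose; rewrite // -fndSome hw.
Qed.

(** Stores that differ only on variables foreign to [c] run in lockstep. This serves [SL_ex], with
    one quantified variable, and erasure, with all auxiliary variables. *)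
Lemma bexec_agree (X : set Var) c s h s' h' s1 :
  bexec c s h s' h' -> fv_bcmd c `&` X = set0 ->
  (forall x, ~ X x -> s x = s1 x) ->
  exists2 s1', bexec c s1 h s1' h' & forall x, ~ X x -> s' x = s1' x.
Proof.
move=> H /set0_disj cX; case: H s1 cX => {s s' h h'}
  [x e s h|x e s h l v el hl|e e' s h l el hl|x e es s h n g bg dg
  |e s h l el hl] s1 /= cX E.
- exists (update s1 x (eval s1 e)); first by constructor.
  rewrite (@eval_agree s1 s e); last first.
    by move=> y ey; rewrite E // => Xy; apply: (cX y) => //; right.
  by move=> y Xy; rewrite /update; case: eqP => // _; exact: E.
- exists (update s1 x v).
    apply: bexec_lookup hl; rewrite -el; apply: eval_agree => y ey.
    by rewrite E // => Xy; apply: (cX y) => //; right.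
  by move=> y Xy; rewrite /update; case: eqP => // _; exact: E.
- exists s1 => //.
  rewrite (@eval_agree s s1 e'); last first.
    by move=> y ey; rewrite E // => Xy; apply: (cX y) => //; right.
  apply: bexec_mutate => //; rewrite -el; apply: eval_agree => y ey.
  by rewrite E // => Xy; apply: (cX y) => //; left.
- exists (update s1 x (addr n)).
    apply: bexec_cons dg; rewrite (@map_eval_agree s1 s) // => y ey.
    by rewrite E // => Xy; apply: (cX y) => //; right.
  by move=> y Xy; rewrite /update; case: eqP => // _; exact: E.
- exists s1 => //.
  apply: bexec_dispose => //; rewrite -el; apply: eval_agree => y ey.
  by rewrite E // => Xy; apply: (cX y) => //; left.
Qed.

Lemma babort_agree (X : set Var) c s h s1 :
  babort c s h -> fv_bcmd c `&` X = set0 ->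
  (forall x, ~ X x -> s x = s1 x) -> babort c s1 h.
Proof.
have D e : dangling s h e -> (forall x, fv_expr e x -> s1 x = s x) ->
    dangling s1 h e.
  by move=> H E l; rewrite (eval_agree E); exact: H.
move=> H /set0_disj cX E; case: c H cX => //= [x e|e e'|e] H cX; apply: (D e H) => y ey;
  rewrite E // => Xy; apply: (cX y) => //; first [by left|by right|by []].
Qed.

(** The tight, fault-avoiding reading of triples: a heap described by [P] contains every cell that
    [c] accesses, which makes the frame rule sound. *)
Definition btriple P c Q := forall s h, sat s h P ->
  ~ babort c s h /\ forall s' h', bexec c s h s' h' -> sat s' h' Q.

Lemma not_dangling1 s h e n v :
  eval s e = addr n -> is_block h n [:: v] -> ~ dangling s h e.
Proof.
move=> en /is_block1 [l ln hl] /(_ l); rewrite ln en => /(_ erefl).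
by rewrite -fndSome hl eqxx.
Qed.

Lemma sl_sound P c Q : sl_derivable Loc P c Q -> btriple P c Q.
Proof.
elim=> {P c Q}.
- move=> x m e xm s h /= [/eqP sxm ->]; split=> // s' h' H; inversion H; subst.
  by rewrite update_same eval_subst.
- move=> x m n e /= /and3P[]; rewrite !inE negb_or => /andP[xm xn] mn _ s h /=
    [[a ea bl] /eqP sxm]; split; first exact: not_dangling1 ea bl.
  move=> s' h' H; inversion H; subst.
  have [l' la hl'] := (is_block1 _ _ _).1 bl.
  have ll' : l = l'.
    by apply/val_inj/addr_inj; rewrite /= la -ea.
  match goal with H : _ = Some _ |- _ => move: H end; rewrite hl' ll' eqxx => -[<-].
  rewrite update_same update_other 1?eq_sym //; split=> //.
  by exists a; rewrite ?eval_subst.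
- move=> y e e' ey s h /sat_ex [v /= [a ea]]; rewrite update_same => bl.
  have ea' : eval s e = addr a.
    rewrite -ea; apply: eval_agree => x ex; rewrite update_other //.
    by apply/eqP => xy; apply: ey; rewrite -xy.
  split; first exact: not_dangling1 ea' bl.
  move=> s' h' H; inversion H; subst.
  have [l' la hl'] := (is_block1 _ _ _).1 bl.
  have ll' : l = l'.
    by apply/val_inj/addr_inj; rewrite /= la -ea'.
  exists a => //; apply/is_block1; exists l'; rewrite // => l1.
  by rewrite fnd_set hl' ll'; case: eqP.
- move=> x m e es xm s h /= [/eqP sxm ->]; split=> // s' h' H; inversion H; subst.
  exists n; rewrite ?update_same // eval_subst // map_eval_subst //.
  rewrite (_ : heap_union _ g = g) //; heaps.
- move=> y e ey s h /sat_ex [v /= [a ea]]; rewrite update_same => bl.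
  have ea' : eval s e = addr a.
    rewrite -ea; apply: eval_agree => x ex; rewrite update_other //.
    by apply/eqP => xy; apply: ey; rewrite -xy.
  split; first exact: not_dangling1 ea' bl.
  move=> s' h' H; inversion H; subst.
  have [l' la hl'] := (is_block1 _ _ _).1 bl.
  have ll' : l = l'.
    by apply/val_inj/addr_inj; rewrite /= la -ea'.
  apply: heap_ext => l1; rewrite fnd_rem1 hl' ll' fnd_fmap0.
  by case: eqP.
- move=> P Q R c _ IH /set0_disj cR s h [h1 [h2 [d -> sP sR]]].
  have [na ex] := IH _ _ sP; split; first by move=> /babort_mono.
  move=> s' k H; have [h' [d' -> H']] := bexec_frame H d na.
  apply: sat_star => //; first exact: ex H'.
  apply: sat_agree sR => x Rx.
  by rewrite (bexec_mod H) // => cx; exact: cR Rx.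
- move=> P P' Q Q' c _ IH PP QQ s h /PP /IH [na ex]; split=> // s' h' /ex.
  exact: QQ.
- move=> P1 P2 Q1 Q2 c _ IH1 _ IH2 s h /= [/IH1[na ex1] /IH2[_ ex2]].
  by split=> // s' h' H; split; [exact: ex1 H|exact: ex2 H].
- move=> P1 P2 Q1 Q2 c _ IH1 _ IH2 s h /sat_or [/IH1|/IH2] [na ex];
  by split=> // s' h' /ex ?; apply/sat_or; tauto.
- move=> x P Q c _ IH cx s h /sat_ex [v /IH [na ex]].
  have cX : fv_bcmd c `&` [set x] = set0.
    by apply/set0_disj => y cy yx; apply: cx; rewrite -yx.
  have E y : y <> x -> s y = update s x v y.
    by move=> /eqP yx; rewrite update_other.
  split=> [ab|s' h' H].
    by apply: na; apply: babort_agree ab cX E.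
  have [s1' H1 E1] := bexec_agree H cX E.
  (* The witness is the final value of [x] in the companion run, started from the store where [x]
     holds the witness of the precondition. *)
  apply/sat_ex; exists (s1' x); apply: sat_agree (ex _ _ H1) => y _.
  rewrite /update; case: eqP => [->//|yx]; symmetry; exact: E1.
Qed.

End Satisfaction.

(** * Resource contexts and precision of the combined invariant *)

Section Contexts.
Context (Var Res : eqType) (Loc : pred nat).
Implicit Types (s : store Var) (h : heap Loc) (G : ctx Var Res)
  (d : rdecl Var Res) (D : set Res) (q : Res).

Lemma lookup_cons d G q :
  lookup (d :: G) q = if rname d == q then Some d else lookup G q.
Proof. by rewrite /lookup /=; case: eqP. Qed.

Lemma lookup_none G q : q \notin map (@rname Var Res) G -> lookup G q = None.
Proof.
elim: G => //= d G IH; rewrite inE negb_or eq_sym lookup_cons.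
by case/andP => /negbTE-> /IH.
Qed.

(** [D_CR] and [D_RES] allow the declaration of [r] anywhere in the context. The lemmas ending in
    [_mid] move it to the front, so that these rules need a proof only for contexts [d :: G]. *)
Lemma lookup_mid G1 d G2 q : rname d \notin map (@rname Var Res) G1 ->
  lookup (G1 ++ d :: G2) q = lookup (d :: G1 ++ G2) q.
Proof.
elim: G1 => //= d1 G1 IH; rewrite inE negb_or => /andP[dd1 /IH E].
rewrite !lookup_cons E lookup_cons; case: eqP => // E1; case: eqP => // E2.
by move: dd1; rewrite E1 E2 eqxx.
Qed.

Lemma pv_cons d G q : pv (d :: G) q = if rname d == q then rvars d else pv G q.
Proof. by rewrite /pv lookup_cons; case: eqP. Qed.

Lemma pv_none G q : ~ res_ctx G q -> pv G q = set0.
Proof. by move=> nq; rewrite /pv lookup_none //; apply/negP. Qed.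

Lemma ctx_ok_cons d G : ctx_ok Loc (d :: G) ->
  [/\ ~ res_ctx G (rname d), precise Loc (rinv d),
      fv_assn (rinv d) `<=` rvars d & ctx_ok Loc G].
Proof.
case=> /= /andP[dG uG] H.
have [pd fd] : precise Loc (rinv d) /\ fv_assn (rinv d) `<=` rvars d.
  by apply: (H (rname d)); rewrite lookup_cons eqxx.
split=> //; first by apply/negP.
split=> // q d' E; apply: (H q); rewrite lookup_cons; case: eqP => // dq.
by move: dG; rewrite dq => /lookup_none; rewrite E.
Qed.

Lemma ctx_ok_mid G1 d G2 :
  ctx_ok Loc (G1 ++ d :: G2) -> ctx_ok Loc (d :: G1 ++ G2).
Proof.
case=> u H; have u' : uniq (map (@rname Var Res) (d :: G1 ++ G2)).
  by move: u; rewrite !map_cat /= -(cat1s (rname d)) uniq_catCA /= map_cat.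
split=> // q d' E; apply: (H q); rewrite lookup_mid //.
by move: u'; rewrite /= map_cat mem_cat negb_or => /andP[/andP[]].
Qed.

Lemma inv_star_cons d G D :
  inv_star (d :: G) D =
  if rname d \in D then AStar (rinv d) (inv_star G D) else inv_star G D.
Proof. by rewrite /inv_star big_cons. Qed.

Lemma sat_inv_star_mid s h G1 d G2 D :
  sat s h (inv_star (G1 ++ d :: G2) D) <-> sat s h (inv_star (d :: G1 ++ G2) D).
Proof.
elim: G1 h => //= d1 G1 IH h; rewrite !inv_star_cons; move: IH; rewrite inv_star_cons.
case: ifP => _; case: ifP => _ //= IH.
- split=> -[h1 [h2 [d12 -> s1]]].
    move=> /IH[h3 [h4 [d34 E s3 s4]]]; subst h2.
    exists h3, (heap_union h1 h4); split=> //; [heaps|heaps|].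
    by exists h1, h4; split=> //; heaps.
  move=> [h3 [h4 [d34 E s3 s4]]]; subst h2.
  exists h3, (heap_union h1 h4); split=> //; [heaps|heaps|].
  by apply/IH; exists h1, h4; split=> //; heaps.
- by split=> -[h1 [h2 [d12 -> s1 /IH s2]]]; exists h1, h2.
Qed.

Lemma inv_star_eqD G D D' : (forall q, res_ctx G q -> (D q <-> D' q)) ->
  inv_star G D = inv_star G D'.
Proof.
elim: G => [|d G IH] E; first by rewrite /inv_star !big_nil.
rewrite !inv_star_cons IH; last by move=> q Gq; apply: E; rewrite /res_ctx /= inE Gq orbT.
suff -> : (rname d \in D) = (rname d \in D') by [].
have := E (rname d); rewrite /res_ctx /= inE eqxx => /(_ isT) e.
by apply/idP/idP; rewrite !in_setE => /e.
Qed.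

Lemma precise_inv_star G D : ctx_ok Loc G -> precise Loc (inv_star G D).
Proof.
elim: G => [|d G IH].
  by rewrite /inv_star big_nil => _ s h h1 h2 _ _ /= -> ->.
case/ctx_ok_cons => _ pd _ /IH pG; rewrite inv_star_cons; case: ifP => // _.
move=> s h h1 h2 [g1 d1 E1] [g2 d2 E2] /= [a1 [b1 [ab1 F1 sa1 sb1]]]
  [a2 [b2 [ab2 F2 sa2 sb2]]]; subst.
(* The factors of both subheaps are themselves subheaps of the same heap, so precision applies to
   each factor separately. *)
have Ea : a1 = a2.
  apply: (pd s (heap_union (heap_union a1 b1) g1)) => //.
  - by exists (heap_union b1 g1); [heaps|heaps].
  - by exists (heap_union b2 g2); [heaps|heaps].
have Eb : b1 = b2.
  apply: (pG s (heap_union (heap_union a1 b1) g1)) => //.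
  - by exists (heap_union a1 g1); [heaps|heaps].
  - by exists (heap_union a2 g2); [heaps|heaps].
by rewrite Ea Eb.
Qed.

(** Precision determines the shared part, and cancelling it determines the private part. Every use
    of precision in the safety proofs goes through this lemma. *)
Lemma split_unique s h k h' k' G D : ctx_ok Loc G ->
  heap_disj h k -> heap_disj h' k' -> heap_union h k = heap_union h' k' ->
  sat s k (inv_star G D) -> sat s k' (inv_star G D) -> h = h' /\ k = k'.
Proof.
move=> Gok d d' E sk sk'; have Ek : k = k'.
  apply: (precise_inv_star Gok (h := heap_union h k) _ _ sk sk').
  - by exists h; [heaps|]; apply: heap_unionC.
  - by exists h'; [heaps|]; rewrite E; apply: heap_unionC.
by split=> //; move: E d; rewrite Ek => E d; heaps.
Qed.

Lemma fv_inv_star G D x : ctx_ok Loc G ->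
  fv_assn (inv_star G D) x -> pv_ctx G x.
Proof.
elim: G => [|d G IH]; first by rewrite /inv_star big_nil.
move=> /ctx_ok_cons[dG _ fd Gok]; rewrite inv_star_cons => H.
have {H} : rvars d x \/ fv_assn (inv_star G D) x.
  by move: H; case: ifP => _ /=; [case=> [/fd|]|]; by [left|right].
case=> [dx|/(IH Gok)[q Gq qx]].
  by exists (rname d); [rewrite /res_ctx /= inE eqxx|rewrite pv_cons eqxx].
exists q; first by rewrite /res_ctx /= inE; apply/orP; right.
by rewrite pv_cons; case: eqP => // dq; case: dG; rewrite dq.
Qed.

Lemma inv_star_agree s s' h G D : ctx_ok Loc G ->
  (forall x, pv_ctx G x -> s x = s' x) ->
  sat s h (inv_star G D) -> sat s' h (inv_star G D).
Proof. by move=> Gok E; apply: sat_agree => x /(fv_inv_star Gok) /E. Qed.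

End Contexts.

(** * Program transitions *)

Ltac setprop := rewrite /rconf_ok /rconf_dom /setU /setI /setD /set1 /mkset /=.

Section Steps.
Context (Var Res : eqType) (Loc : pred nat).
Implicit Types (s : store Var) (h : heap Loc) (C : cmd Var Res)
  (p : rconf Res) (O L D : set Res) (q r : Res).

Lemma rconf_eq p p' :
  (forall q, [/\ rO p q <-> rO p' q, rL p q <-> rL p' q & rD p q <-> rD p' q]) ->
  p = p'.
Proof.
case: p p' => O L D [O' L' D'] /= E.
by congr RConf; apply/seteqP; split=> q; case: (E q) => -[? ?] [? ?] [? ?].
Qed.

Lemma rconf_okP p : rconf_ok p <->
  (forall q, [/\ ~ (rO p q /\ rL p q), ~ (rO p q /\ rD p q)
               & ~ (rL p q /\ rD p q)]).
Proof.
split=> [[/set0_disj a /set0_disj b /set0_disj c] q|H].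
  by split=> -[]; [exact: a|exact: b|exact: c].
by split; apply/set0_disj => q x y; case: (H q) => a b c;
  [apply: a|apply: b|apply: c].
Qed.

Lemma pstep_conv C s h p C' s' h' p' p1 p1' :
  pstep C s h p C' s' h' p' -> p = p1 -> p' = p1' ->
  pstep C s h p1 C' s' h' p1'.
Proof. by move=> H <- <-. Qed.

Lemma rconf_okRO O L D r : rconf_ok (RConf O L D) ->
  ~ rconf_dom (RConf O L D) r -> rconf_ok (RConf (r |` O) L D).
Proof.
move=> /rconf_okP ok nr; apply/rconf_okP => q; move: (ok q) nr; setprop.
by case=> ? ? ? nr; split; have [E|?] := EM (q = r); try subst; tauto.
Qed.

Lemma rconf_okRD O L D r : rconf_ok (RConf O L D) ->
  ~ rconf_dom (RConf O L D) r -> rconf_ok (RConf O L (r |` D)).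
Proof.
move=> /rconf_okP ok nr; apply/rconf_okP => q; move: (ok q) nr; setprop.
by case=> ? ? ? nr; split; have [E|?] := EM (q = r); try subst; tauto.
Qed.

Lemma rconf_okDO O L D r : rconf_ok (RConf O L D) -> rconf_ok (RConf (O `\ r) L D).
Proof.
move=> /rconf_okP ok; apply/rconf_okP => q; move: (ok q); setprop.
by case=> ? ? ?; split; tauto.
Qed.

Lemma rconf_delO O L D r : rconf_ok (RConf O L D) -> O r ->
  rconf_del (RConf O L D) r = RConf (O `\ r) L D.
Proof.
move=> /rconf_okP ok Or; apply: rconf_eq => q; move: (ok r); setprop.
by case=> ? ? ?; have [E|?] := EM (q = r); try subst; split; tauto.
Qed.

(** Only [pstep_W0] and [pstep_W2] move names, and only between O and D. For a local resource,
    freshness of [r] ensures that deleting it afterwards removes nothing that was there before. *)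
Lemma pstep_rconf C s h p C' s' h' p' : pstep C s h p C' s' h' p' ->
  rconf_ok p -> [/\ rconf_ok p', rL p' = rL p &
    forall q, rO p' q \/ rD p' q <-> rO p q \/ rD p q].
Proof.
elim=> {C s h p C' s' h' p'} //=.
- move=> r C s h O L D C' s' h' [O' L' D'] nr _ _ IH ok.
  have [/rconf_okP ok' /= EL E] := IH (rconf_okRO ok nr).
  subst L'; split.
  + by apply/rconf_okP => q; move: (ok' q); setprop => -[? ? ?]; split; tauto.
  + apply/seteqP; split=> q; setprop; first by tauto.
    by move=> Lq; split=> // E1; subst; apply: nr; setprop; tauto.
  + move=> q; move: (E q) nr; setprop => -[? ?] nr.
    by have [E1|?] := EM (q = r); try subst; split; tauto.
- move=> r C s h O L D C' s' h' [O' L' D'] nr _ _ IH ok.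
  have [/rconf_okP ok' /= EL E] := IH (rconf_okRD ok nr).
  subst L'; split.
  + by apply/rconf_okP => q; move: (ok' q); setprop => -[? ? ?]; split; tauto.
  + apply/seteqP; split=> q; setprop; first by tauto.
    by move=> Lq; split=> // E1; subst; apply: nr; setprop; tauto.
  + move=> q; move: (E q) nr; setprop => -[? ?] nr.
    by have [E1|?] := EM (q = r); try subst; split; tauto.
- move=> r B C s h O L D Dr _ /rconf_okP ok; split=> //.
  + apply/rconf_okP => q; move: (ok q) (ok r); setprop => -[? ? ?] [? ? ?].
    by have [E1|?] := EM (q = r); try subst; split; tauto.
  + by move=> q; setprop; have [E1|?] := EM (q = r); try subst; tauto.
- move=> r C s h O L D C' s' h' O' L' D' Or _ IH /[dup] ok0 /rconf_okP ok.
  have [/rconf_okP ok' /= EL E] := IH (rconf_okDO r ok0).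
  subst L'; split=> //.
  + apply/rconf_okP => q; move: (ok r) (ok' q) (E r); setprop.
    move=> -[? ? ?] [? ? ?] [? ?].
    by have [E1|?] := EM (q = r); try subst; split; tauto.
  + move=> q; move: (E q); setprop => -[? ?].
    by have [E1|?] := EM (q = r); try subst; tauto.
- move=> r s h O L D Or /rconf_okP ok; split=> //.
  + apply/rconf_okP => q; move: (ok q) (ok r); setprop => -[? ? ?] [? ? ?].
    by have [E1|?] := EM (q = r); try subst; split; tauto.
  + by move=> q; setprop; have [E1|?] := EM (q = r); try subst; tauto.
Qed.

(* The shape of the commands reachable from unextended ones: only active
   subcommands hold resources, and no resource is held twice. *)
Fixpoint wfc C : Prop :=
  match C with
  | Skip | Basic _ => True
  | Seq C1 C2 => wfc C1 /\ unextended C2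
  | If _ C1 C2 => unextended C1 /\ unextended C2
  | While _ C1 | With _ _ C1 => unextended C1
  | Resource _ C1 => wfc C1
  | Within r C1 => wfc C1 /\ ~ locked C1 r
  | Par C1 C2 => [/\ wfc C1, wfc C2 & forall q, locked C1 q -> locked C2 q -> False]
  end.

Lemma unextended_wfc C : unextended C -> wfc C /\ forall q, ~ locked C q.
Proof.
elim: C => [|c|C1 IH1 C2 IH2|B C1 IH1 C2 IH2|B C IH|r C IH|r B C IH|r C IH
  |C1 IH1 C2 IH2] //=; try by move=> *; split=> // ? [].
- by move=> /andP[/IH1[? ?] ?].
- by move=> /andP[? ?]; split=> // ? [].
- by move=> /IH[? N]; split=> // q [/N].
- move=> /andP[/IH1[? N1] /IH2[? N2]]; split.
    by split=> // q /N1.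
  by move=> q [/N1|/N2].
Qed.

(** O may exceed the locks of [C], because a component of a parallel command runs in a configuration
    whose O also contains the names held by its sibling. The last clause says that this surplus is
    untouched, which keeps newly acquired locks disjoint from those of the sibling. *)
Lemma pstep_locked C s h p C' s' h' p' : pstep C s h p C' s' h' p' ->
  rconf_ok p -> wfc C -> (forall q, locked C q -> rO p q) ->
  wfc C' /\ forall q, (locked C' q -> rO p' q) /\
    (rO p' q /\ ~ locked C' q <-> rO p q /\ ~ locked C q).
Proof.
elim=> {C s h p C' s' h' p'} //=.
- move=> C2 s h p ok [_ /unextended_wfc[w N]] _; split=> // q.
  by move: (N q); setprop; tauto.
- move=> C1 C2 s h p C1' s' h' p' _ IH ok [w1 u2] l1.
  by have [] := IH ok w1 l1.
- move=> B C s h p ok u l; split; first by rewrite u.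
  by move=> q; setprop; tauto.
- move=> B C1 C2 s h p _ ok [/unextended_wfc[w N] _] _; split=> // q.
  by move: (N q); setprop; tauto.
- move=> B C1 C2 s h p _ ok [_ /unextended_wfc[w N]] _; split=> // q.
  by move: (N q); setprop; tauto.
- move=> C1 C2 s h p C1' s' h' p' H IH ok [w1 w2 dj] l.
  have [w1' l1'] := IH ok w1 (fun q x => l q (or_introl x)).
  have [/rconf_okP ok' _ E] := pstep_rconf H ok.
  have dj' q : locked C1' q -> locked C2 q -> False.
    move: (l q) (l1' q) (dj q); setprop; tauto.
  split=> // q; move: (l q) (l1' q) (dj q) (dj' q); setprop.
  by have := EM (locked C2 q); tauto.
- move=> C1 C2 s h p C2' s' h' p' H IH ok [w1 w2 dj] l.
  have [w2' l2'] := IH ok w2 (fun q x => l q (or_intror x)).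
  have [/rconf_okP ok' _ E] := pstep_rconf H ok.
  have dj' q : locked C1 q -> locked C2' q -> False.
    move: (l q) (l2' q) (dj q); setprop; tauto.
  split=> // q; move: (l q) (l2' q) (dj q) (dj' q); setprop.
  by have := EM (locked C1 q); tauto.
- by move=> s h p _ _ _; split=> // q; setprop; tauto.
- by move=> r s h p nr _ _ _; split=> // q; setprop; tauto.
- move=> r C s h O L D C' s' h' p' nr lr H IH ok w l.
  have [|w' l'] := IH (rconf_okRO ok nr) w.
    move=> q; move: (l q); setprop.
    by have [E1|?] := EM (q = r); try subst; tauto.
  split=> // q; move: (l q) (l' q) nr; setprop.
  by have [E1|?] := EM (q = r); try subst; tauto.
- move=> r C s h O L D C' s' h' p' nr lr H IH ok w l.
  have [|w' l'] := IH (rconf_okRD ok nr) w.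
    move=> q; move: (l q); setprop.
    by have [E1|?] := EM (q = r); try subst; tauto.
  split=> // q; move: (l q) (l' q) nr; setprop.
  by have [E1|?] := EM (q = r); try subst; tauto.
- move=> r B C s h O L D Dr _ /rconf_okP ok /unextended_wfc[w N] _.
  split=> // q; move: (N q) (ok q); setprop => ? [? ? ?].
  by have [E1|?] := EM (q = r); try subst; tauto.
- move=> r C s h O L D C' s' h' O' L' D' Or H IH ok [w lr] l.
  have [|w' l'] := IH (rconf_okDO r ok) w.
    move=> q; move: (l q); setprop.
    by have [E1|?] := EM (q = r); try subst; tauto.
  have [ok' _ E] := pstep_rconf H (rconf_okDO r ok).
  (* The body runs with [r] in neither O nor D, and a step only exchanges names between these two,
     so it cannot acquire [r] again. *)
  have lr' : ~ locked C' r.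
    by move: ok => /rconf_okP/(_ r) [_ od _]; move: od (l' r) (E r); setprop; tauto.
  split=> // q; move: (l q) (l' q); setprop.
  by have [E1|?] := EM (q = r); try subst; tauto.
- by move=> r s h O L D Or _ _ l; split=> // q; setprop; tauto.
Qed.

Lemma chng_mod C x : chng C x -> mod_cmd C x.
Proof.
by elim: C => //= [C1 IH1 C2 IH2 /IH1|C1 IH1 C2 IH2 [/IH1|/IH2]];
  [left|left|right].
Qed.

Lemma pstep_mod C s h p C' s' h' p' x :
  pstep C s h p C' s' h' p' -> mod_cmd C' x -> mod_cmd C x.
Proof.
elim=> {C s h p C' s' h' p'} //=; setprop; intros; tauto.
Qed.

Lemma pstep_chng C s h p C' s' h' p' :
  pstep C s h p C' s' h' p' -> forall x, ~ chng C x -> s' x = s x.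
Proof.
elim=> {C s h p C' s' h' p'} //=.
- by move=> C1 C2 s h p C1' s' h' p' _ IH x N; apply: IH => ?; apply: N; left.
- by move=> C1 C2 s h p C1' s' h' p' _ IH x N; apply: IH => ?; apply: N; right.
- by move=> c s h p s' h' /bexec_mod.
Qed.

Lemma pabort_mono C s h hF p :
  pabort C s (heap_union h hF) p -> pabort C s h p.
Proof.
move E: (heap_union h hF) => h0 H; elim: H E => {C s h0 p}; intros; subst.
all: try by constructor; auto.
- by constructor; apply: babort_mono H.
Qed.

(** Lifts [bexec_frame] along the evaluation context. At [Within], the abort rule deletes [r] from
    all three components and the step rule only from O; disjointness of the components identifies
    the two configurations. *)
Lemma pstep_frame C s h hF p C' s' k p' :
  pstep C s (heap_union h hF) p C' s' k p' -> rconf_ok p ->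
  heap_disj h hF -> ~ pabort C s h p ->
  exists h', [/\ heap_disj h' hF, k = heap_union h' hF &
    pstep C s h p C' s' h' p'].
Proof.
move E: (heap_union h hF) => h0 H.
elim: H E => {C s h0 p C' s' k p'}; intros; subst.
all: try by exists h; split=> //; constructor.
- have [|g [? ? ?]] := H0 erefl H1 H2; first by move=> ab; apply: H3; constructor.
  by exists g; split=> //; constructor.
- have [|g [? ? ?]] := H0 erefl H1 H2; first by move=> ab; apply: H3; constructor.
  by exists g; split=> //; constructor.
- have [|g [? ? ?]] := H0 erefl H1 H2.
    by move=> ab; apply: H3; apply: pabort_PA2.
  by exists g; split=> //; apply: pstep_P2.
- have [|g [? ? ?]] := H2 erefl (rconf_okRO H3 H) H4.
    by move=> ab; apply: H5; apply: pabort_RA1.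
  by exists g; split=> //; apply: pstep_R1.
- have [|g [? ? ?]] := H2 erefl (rconf_okRD H3 H) H4.
    by move=> ab; apply: H5; apply: pabort_RA2.
  by exists g; split=> //; apply: pstep_R2.
- have [|g [? ? ?]] := H1 erefl (rconf_okDO r H2) H3.
    by move=> ab; apply: H4; apply: pabort_WA1; rewrite rconf_delO.
  by exists g; split=> //; apply: pstep_W1.
- have [|g [? ? ?]] := bexec_frame H H1; first by move=> ab; apply: H2; constructor.
  by exists g; split=> //; constructor.
Qed.

(* The view that one thread has of the configuration when the resources in K
   are held by the other threads. *)
Definition hide_res (K : set Res) p : rconf Res :=
  RConf (rO p `\` K) (rL p `|` K) (rD p).

Lemma hide_res_ok (K : set Res) p : rconf_ok p -> (forall q, K q -> rO p q) ->
  rconf_ok (hide_res K p).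
Proof.
move=> /rconf_okP ok Kp; apply/rconf_okP => q; move: (ok q) (Kp q); setprop.
by case=> *; split; tauto.
Qed.

Lemma hide_res_O (K : set Res) O L D r : ~ K r ->
  hide_res K (RConf (r |` O) L D) = RConf (r |` (O `\` K)) (L `|` K) D.
Proof.
move=> nK; apply: rconf_eq => q; setprop.
by have [E|?] := EM (q = r); try subst; split; tauto.
Qed.

Lemma hide_res_delO (K : set Res) O L D r :
  hide_res K (RConf (O `\ r) L D) = RConf ((O `\` K) `\ r) (L `|` K) D.
Proof. by apply: rconf_eq => q; setprop; split; tauto. Qed.

Lemma hide_res_del (K : set Res) p r : ~ K r ->
  hide_res K (rconf_del p r) = rconf_del (hide_res K p) r.
Proof.
move=> nK; apply: rconf_eq => q; setprop.
by have [E|?] := EM (q = r); try subst; split; tauto.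
Qed.

Lemma hide_res_dom (K : set Res) p r : (forall q, K q -> rO p q) ->
  rconf_dom (hide_res K p) r <-> rconf_dom p r.
Proof. by move=> Kp; move: (Kp r); setprop; have := EM (K r); tauto. Qed.

(** Hiding keeps the set of known names and only shrinks O, so aborts persist; at [Within], the loss
    of [r] from O is itself an abort. *)
Lemma pabort_hide (K : set Res) C s h p : pabort C s h p -> rconf_ok p ->
  (forall q, K q -> rO p q) -> pabort C s h (hide_res K p).
Proof.
elim=> {C s h p}.
- by move=> r C s h p pr _ Kp; constructor; apply/hide_res_dom.
- by move=> r B C s h p pr _ Kp; constructor => /hide_res_dom; auto.
- move=> r C s h O L D nr lr ab IH ok Kp.
  have nK : ~ K r by move=> Kr; apply: nr; left; left; apply: Kp.
  apply: pabort_RA1 => //; first by move=> /(hide_res_dom r Kp).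
  rewrite -hide_res_O //; apply: IH; first exact: rconf_okRO.
  by move=> q Kq; right; apply: Kp.
- move=> r C s h O L D nr lr ab IH ok Kp.
  have nK : ~ K r by move=> Kr; apply: nr; left; left; apply: Kp.
  apply: pabort_RA2 => //; first by move=> /(hide_res_dom r Kp).
  by apply: IH => //; exact: rconf_okRD.
- by move=> *; constructor.
- by move=> C1 C2 s h p _ IH ok Kp; constructor; apply: IH.
- move=> r C s h p _ IH ok Kp; have [Or|nO] := EM (rO (hide_res K p) r);
    last by apply: pabort_WA2.
  case: Or => Or nK; apply: pabort_WA1; rewrite -hide_res_del //.
  apply: IH; case: p ok Kp Or => O L D ok Kp Or; rewrite rconf_delO //.
    exact: rconf_okDO.
  by move=> q Kq; split; [exact: Kp|move=> E; apply: nK; rewrite -E].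
- by move=> r C s h p nO ok Kp; apply: pabort_WA2 => -[].
- by move=> C1 C2 s h p _ IH ok Kp; apply: pabort_PA1; apply: IH.
- by move=> C1 C2 s h p _ IH ok Kp; apply: pabort_PA2; apply: IH.
Qed.

(** A step can depend on a lock in [K] only through [Within], and in the restricted view that would
    be an abort by [pabort_WA2]. An acquisition takes a name from D, which is disjoint from [K]. *)
Lemma pstep_hide (K : set Res) C s h p C' s' h' p' :
  pstep C s h p C' s' h' p' -> rconf_ok p ->
  (forall q, K q -> rO p q) -> ~ pabort C s h (hide_res K p) ->
  pstep C s h (hide_res K p) C' s' h' (hide_res K p') /\
  (forall q, K q -> rO p' q).
Proof.
elim=> {C s h p C' s' h' p'}; try by move=> *; split=> //; constructor.
- move=> C1 C2 s h p C1' s' h' p' _ IH ok Kp na.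
  have [|H Kp'] := IH ok Kp; first by move=> ab; apply: na; constructor.
  by split=> //; constructor.
- move=> C1 C2 s h p C1' s' h' p' _ IH ok Kp na.
  have [|H Kp'] := IH ok Kp; first by move=> ab; apply: na; constructor.
  by split=> //; constructor.
- move=> C1 C2 s h p C1' s' h' p' _ IH ok Kp na.
  have [|H Kp'] := IH ok Kp; first by move=> ab; apply: na; apply: pabort_PA2.
  by split=> //; apply: pstep_P2.
- move=> r s h p nr ok Kp na; split=> //; apply: pstep_R0.
  by move/(hide_res_dom r Kp).
- move=> r C s h O L D C' s' h' p' nr lr _ IH ok Kp na.
  have nK : ~ K r by move=> Kr; apply: nr; left; left; apply: Kp.
  have nr' : ~ rconf_dom (hide_res K (RConf O L D)) r by move/(hide_res_dom r Kp).
  have [q Kq||H Kp'] := IH (rconf_okRO ok nr); first by right; apply: Kp.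
    by rewrite hide_res_O // => ab; apply: na; apply: pabort_RA1.
  split; last first.
    by move=> q Kq; split; [exact: Kp'|move=> E; apply: nK; rewrite -E].
  by rewrite hide_res_del //; apply: pstep_R1 => //; rewrite -hide_res_O.
- move=> r C s h O L D C' s' h' p' nr lr _ IH ok Kp na.
  have nK : ~ K r by move=> Kr; apply: nr; left; left; apply: Kp.
  have nr' : ~ rconf_dom (hide_res K (RConf O L D)) r by move/(hide_res_dom r Kp).
  have [|H Kp'] := IH (rconf_okRD ok nr) Kp.
    by move=> ab; apply: na; apply: pabort_RA2.
  split; last first.
    by move=> q Kq; split; [exact: Kp'|move=> E; apply: nK; rewrite -E].
  by rewrite hide_res_del //; apply: pstep_R2.
- move=> r B C s h O L D Dr sB /rconf_okP ok Kp _; split; last by right; apply: Kp.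
  rewrite hide_res_O; first exact: pstep_W0.
  by move=> /Kp /= Or; case: (ok r) => _ + _; apply.
- move=> r C s h O L D C' s' h' O' L' D' Or _ IH ok Kp na.
  have [_ nK] : (O `\` K) r.
    by apply: contrapT => N; apply: na; apply: pabort_WA2.
  have [q Kq||H Kp'] := IH (rconf_okDO r ok).
  + by split; [exact: Kp|move=> E; apply: nK; rewrite -E].
  + move=> ab; apply: na; apply: pabort_WA1.
    by rewrite -hide_res_del // rconf_delO.
  split; last by right; apply: Kp'.
  rewrite hide_res_O //; apply: pstep_W1 => //.
  by rewrite -hide_res_delO.
- move=> r s h O L D Or ok Kp na.
  have [_ nK] : (O `\` K) r.
    by apply: contrapT => N; apply: na; apply: pabort_WA2.
  split; last by move=> q Kq; split; [exact: Kp|move=> E; apply: nK; rewrite -E].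
  by rewrite hide_res_delO; apply: pstep_W2.
Qed.

End Steps.

(** * Safety *)

Section Safety.
Context (Var Res : eqType) (Loc : pred nat).
Implicit Types (s : store Var) (h hG hR : heap Loc) (C : cmd Var Res)
  (p : rconf Res) (G : ctx Var Res) (P Q R : assn Var) (A X : set Var)
  (B : bexpr Var) (O L D : set Res) (q r : Res).

Lemma pstep_skipE s h p C' s' h' p' : ~ pstep (Skip : cmd Var Res) s h p C' s' h' p'.
Proof. by move=> H; inversion H. Qed.

Lemma pstep_basicE c s h p C' s' h' p' : pstep (Basic c : cmd Var Res) s h p C' s' h' p' ->
  [/\ C' = Skip, p' = p & bexec c s h s' h'].
Proof. by move=> H; inversion H. Qed.

Lemma pstep_seqE C1 C2 s h p C' s' h' p' : pstep (Seq C1 C2) s h p C' s' h' p' ->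
  [/\ C1 = Skip, C' = C2, s' = s, h' = h & p' = p] \/
  exists2 C1', C' = Seq C1' C2 & pstep C1 s h p C1' s' h' p'.
Proof. by move=> H; inversion H; subst; [left|right; exists C1']. Qed.

Lemma pstep_ifE B C1 C2 s h p C' s' h' p' : pstep (If B C1 C2) s h p C' s' h' p' ->
  [/\ C' = if beval s B then C1 else C2, s' = s, h' = h & p' = p].
Proof. by move=> H; inversion H; subst; split=> //;
  match goal with E : is_true _ |- _ => move: E end; case: ifP. Qed.

Lemma pstep_whileE B C s h p C' s' h' p' : pstep (While B C) s h p C' s' h' p' ->
  [/\ C' = If B (Seq C (While B C)) Skip, s' = s, h' = h & p' = p].
Proof. by move=> H; inversion H. Qed.

Lemma pstep_parE C1 C2 s h p C' s' h' p' : pstep (Par C1 C2) s h p C' s' h' p' ->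
  [\/ exists2 C1', C' = Par C1' C2 & pstep C1 s h p C1' s' h' p',
      exists2 C2', C' = Par C1 C2' & pstep C2 s h p C2' s' h' p' |
      [/\ C1 = Skip, C2 = Skip & [/\ C' = Skip, s' = s, h' = h & p' = p]]].
Proof.
by move=> H; inversion H; subst;
  [apply: Or31; exists C1'|apply: Or32; exists C2'|apply: Or33].
Qed.

Lemma pstep_withE r B C s h p C' s' h' p' : pstep (With r B C) s h p C' s' h' p' ->
  [/\ C' = Within r C, s' = s & h' = h] /\
  [/\ rD p r, beval s B & p' = RConf (r |` rO p) (rL p) (rD p `\ r)].
Proof. by move=> H; inversion H. Qed.

Lemma pstep_withinE r C s h p C' s' h' p' : pstep (Within r C) s h p C' s' h' p' ->
  rO p r /\
  ([/\ C = Skip, C' = Skip, s' = s, h' = h &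
      p' = RConf (rO p `\ r) (rL p) (r |` rD p)] \/
   exists C1 p1, [/\ C' = Within r C1,
      pstep C s h (RConf (rO p `\ r) (rL p) (rD p)) C1 s' h' p1 &
      p' = RConf (r |` rO p1) (rL p1) (rD p1)]).
Proof.
move=> H; inversion H; subst; split=> //; last by left.
by right; exists C'0, (RConf O' L' D').
Qed.

(* The configuration in which the body of [Resource r C] runs. *)
Definition enter r C p : rconf Res :=
  if `[< locked C r >] then RConf (r |` rO p) (rL p) (rD p)
  else RConf (rO p) (rL p) (r |` rD p).

Lemma pstep_resourceE r C s h p C' s' h' p' :
  pstep (Resource r C) s h p C' s' h' p' -> ~ rconf_dom p r /\
  ([/\ C = Skip, C' = Skip, s' = s, h' = h & p' = p] \/
   exists C1 p1, [/\ C' = Resource r C1, p' = rconf_del p1 r &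
      pstep C s h (enter r C p) C1 s' h' p1]).
Proof.
move=> H; inversion H; subst; split=> //; first by left.
- by right; exists C'0, p'0; split=> //; rewrite /enter asboolT.
- by right; exists C'0, p'0; split=> //; rewrite /enter asboolF.
Qed.

Lemma pabort_resourceE r C s h p : pabort (Resource r C) s h p ->
  ~ rconf_dom p r -> pabort C s h (enter r C p).
Proof.
by move=> H; inversion H; subst=> // _; rewrite /enter; [rewrite asboolT|rewrite asboolF].
Qed.

Lemma pstep_enter r C s h p C1 s' h' p1 : ~ rconf_dom p r ->
  pstep C s h (enter r C p) C1 s' h' p1 ->
  pstep (Resource r C) s h p (Resource r C1) s' h' (rconf_del p1 r).
Proof.
case: p => O L D nr; rewrite /enter; case: asboolP => lr.
  exact: pstep_R1.
exact: pstep_R2.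
Qed.

(* Invariant of the configurations reachable from (set0, L, D). *)
Definition good G C p : Prop :=
  [/\ rconf_ok p, wfc C, (forall q, rO p q <-> locked C q) &
      (forall q, rconf_dom p q <-> res_ctx G q)].

Lemma good_pstep G C s h p C' s' h' p' :
  pstep C s h p C' s' h' p' -> good G C p -> good G C' p'.
Proof.
move=> H [ok w Ol dom].
have [w' l'] := pstep_locked H ok w (fun q => (Ol q).2).
have [ok' EL E] := pstep_rconf H ok.
split=> // q; first by move: (EM (locked C' q)) (l' q) (Ol q); tauto.
by rewrite -dom; move: (E q); setprop; rewrite EL; tauto.
Qed.

Lemma good_env G C A s p s' p' : env_rel A s p s' p' -> good G C p -> good G C p'.
Proof.
move=> [_ ok' _ EO ELD] [ok w Ol dom]; split=> //; first by rewrite EO.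
have E q : rL p' q \/ rD p' q <-> rL p q \/ rD p q.
  by move: (congr1 (@^~ q) ELD); setprop => ->.
by move=> q; rewrite -dom; move: (E q); setprop; rewrite EO; tauto.
Qed.

Lemma good_init G C L D : unextended C -> L `&` D = set0 ->
  L `|` D = res_ctx G -> good G C (RConf set0 L D).
Proof.
move=> /unextended_wfc[w N] LD E; split=> //.
- by split=> //; rewrite /= set0I.
- by move=> q; split=> // /N.
- by move=> q; rewrite -E; setprop; tauto.
Qed.

Lemma env_rel_sub A A' s p s' p' : A' `<=` A ->
  env_rel A s p s' p' -> env_rel A' s p s' p'.
Proof. by move=> AA [? ? E ? ?]; split=> // x /AA/E. Qed.

Definition lockpv G C : set Var := \bigcup_(r in locked C) pv G r.

Lemma estepE A G C s k p C' s' k' p' : estep A G C s k p C' s' k' p' ->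
  exists h hG hG', [/\ [/\ C' = C, heap_union h hG = k & k' = heap_union h hG'],
    env_rel (A `|` lockpv G C) s p s' p',
    heap_disj h hG, heap_disj h hG' &
    sat s hG (inv_star G (rD p)) /\ sat s' hG' (inv_star G (rD p'))].
Proof.
by case=> {C s k p C' s' k' p'} C s h hG p s' hG' p' *; exists h, hG, hG'.
Qed.

(* By precision of the invariants, an environment transition leaves the
   private heap unchanged. *)
Lemma safeS n C s h p G Q A : ctx_ok Loc G ->
  safe n.+1 C s h p G Q A <->
  [/\ C = Skip -> sat s h Q,
      ~ pabort C s h p,
      forall x r, chng C x -> rL p r \/ rD p r -> ~ pv G r x,
      forall hG, heap_disj h hG -> sat s hG (inv_star G (rD p)) ->
        forall C' s' k p', pstep C s (heap_union h hG) p C' s' k p' ->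
        exists h' hG', [/\ heap_disj h' hG', k = heap_union h' hG',
          sat s' hG' (inv_star G (rD p')) & safe n C' s' h' p' G Q A] &
      forall hG hG' s' p', env_rel (A `|` lockpv G C) s p s' p' ->
        heap_disj h hG -> heap_disj h hG' -> sat s hG (inv_star G (rD p)) ->
        sat s' hG' (inv_star G (rD p')) -> safe n C s' h p' G Q A].
Proof.
move=> Gok; split.
  case=> H1 H2 H3 H4; split=> //.
  - move=> x r Cx LDr rx; have : (chng C `&` \bigcup_(r in rL p `|` rD p) pv G r) x.
      by split=> //; exists r.
    by rewrite H3.
  - by move=> hG d sG C' s' k p' H; apply: H4 d sG _ _ _ _ _; left.
  - move=> hG hG' s' p' er d d' sG sG'.
    have [|h1 [hG1 [d1 E sG1 S]]] := H4 hG d sG C s' (heap_union h hG') p'.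
      by right; constructor.
    by have [-> _] := split_unique Gok d' d1 E sG' sG1.
case=> H1 H2 H3 H4 H5; split=> //.
- by apply/set0_disj => x Cx [r /= LDr rx]; apply: H3 rx.
- move=> hG d sG C' s' k p' [H|H]; first exact: H4 H.
  have [h0 [hG0 [hG1 [[EC E Ek] er d0 d1 [sG0 sG1]]]]] := estepE H.
  have [? ?] := split_unique Gok d0 d E sG0 sG; subst.
  by exists h, hG1; split=> //; exact: H5 er d d1 sG0 sG1.
Qed.

End Safety.

(** * Sequential rules, frame and conjunction *)

Section Rules.
Context (Var Res : eqType) (Loc : pred nat).
Implicit Types (s : store Var) (h hG hR : heap Loc) (C : cmd Var Res)
  (p : rconf Res) (G : ctx Var Res) (P Q R : assn Var) (A X : set Var)
  (B : bexpr Var) (O L D : set Res) (q r : Res).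

(** A larger [A] leaves the environment fewer transitions. The context enters [safe] only through
    [pv] and the meaning of [inv_star], so reordering declarations is covered as well. *)
Lemma safe_weaken n C s h p G G' Q Q' A A' :
  pv G = pv G' ->
  (forall s h D, sat s h (inv_star G D) <-> sat s h (inv_star G' D)) ->
  entails Loc Q Q' -> A `<=` A' ->
  safe n C s h p G Q A -> safe n C s h p G' Q' A'.
Proof.
move=> Epv Einv QQ AA; elim: n C s h p => //= n IH C s h p [H1 H2 H3 H4].
split=> //; [by move=> /H1/QQ|by rewrite -Epv|].
move=> hG d /Einv sG C' s' k p' H.
have [|h' [hG' [d' E sG' S]]] := H4 hG d sG C' s' k p'.
  case: H => H; [by left|right]; move: H.
  move=> /estepE[h0 [hG0 [hG1 [[-> <- ->] er d0 d1 [/Einv s0 /Einv s1]]]]].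
  constructor=> //; apply: env_rel_sub er; rewrite /lockpv Epv.
  by apply: setSU.
by exists h', hG'; split=> //; [apply/Einv|exact: IH].
Qed.

Lemma safe_skip n s h p G Q A : ctx_ok Loc G -> fv_assn Q `<=` A ->
  sat s h Q -> safe n Skip s h p G Q A.
Proof.
move=> Gok QA; elim: n s p => // n IH s p sQ; apply/safeS => //; split=> //.
- by move=> H; inversion H.
- by move=> hG d sG C' s' k p' /pstep_skipE.
- move=> hG hG' s' p' [_ _ E _ _] *; apply: IH; apply: sat_agree sQ => x Qx.
  by apply: E; left; apply: QA.
Qed.

Lemma safe_basic n c s h p G P Q A : ctx_ok Loc G -> fv_assn P `<=` A ->
  fv_assn Q `<=` A -> btriple Loc P c Q -> mod_bcmd c `&` pv_ctx G = set0 ->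
  sat s h P -> safe n (Basic c) s h p G Q A.
Proof.
move=> Gok PA QA tr /set0_disj cG; elim: n s p => // n IH s p sP.
have [na ex] := tr _ _ sP.
have cpv x r : mod_bcmd c x -> ~ pv G r x.
  move=> cx rx; apply: (cG x) => //; exists r => //=.
  by apply: contrapT => nr; move: rx; rewrite pv_none.
apply/safeS => //; split=> //.
- by move=> H; inversion H.
- by move=> x r /= cx _; exact: cpv.
- move=> hG d sG C' s' k p' /pstep_basicE[-> -> H].
  have [h' [d' -> H']] := bexec_frame H d na.
  exists h', hG; split=> //; last by apply: safe_skip => //; exact: ex H'.
  apply: inv_star_agree sG => // x Gx; symmetry; apply: (bexec_mod H) => cx.
  exact: cG Gx.
- move=> hG hG' s' p' [_ _ E _ _] *; apply: IH; apply: sat_agree sP => x Px.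
  by apply: E; left; apply: PA.
Qed.

(** Not restricted to initial configurations: the second command of a sequence starts in whatever
    configuration the first one and the environment leave behind. *)
Definition valid n G A P C Q := forall s h p,
  good G C p -> sat s h P -> safe (Loc := Loc) n C s h p G Q A.

(** [C1] stands for any intermediate command, and [C2] starts after an unknown number of steps,
    hence at an unknown smaller index. The bound [m <= n] allows a loop to take itself as [C2]. *)
Lemma safe_seq n C1 C2 s h p G P Q A1 A2 : ctx_ok Loc G ->
  good G (Seq C1 C2) p -> safe n C1 s h p G P A1 ->
  (forall m, m <= n -> valid m G A2 P C2 Q) ->
  safe n (Seq C1 C2) s h p G Q (A1 `|` A2).
Proof.
move=> Gok; elim: n C1 s h p => // n IH C1 s h p gd.
move=> /(safeS _ _ _ _ _ _ _ Gok)[H1 H2 H3 H4 H5] V; apply/safeS => //; split=> //.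
- by move=> H; inversion H.
- move=> hG d sG C' s' k p' H; have gd' := good_pstep H gd.
  move: H gd' => /pstep_seqE[[E1 -> -> -> ->]|[C1' E H]] gd'.
    exists h, hG; split=> //; apply: (@safe_weaken _ _ _ _ _ G _ Q _ A2) => //.
    by apply: V => //; exact: H1.
  have [h' [hG' [d' -> sG' S]]] := H4 _ d sG _ _ _ _ H.
  exists h', hG'; split=> //; rewrite E; apply: IH => //; first by rewrite -E.
  by move=> m mn; apply: V; apply: leqW.
- move=> hG hG' s' p' er d d' sG sG'; apply: IH.
  + exact: good_env er gd.
  + by apply: H5 sG sG' => //; apply: env_rel_sub er; apply: setSU; left.
  + by move=> m mn; apply: V; apply: leqW.
Qed.

Lemma valid_if n B C1 C2 G P Q A1 A2 : ctx_ok Loc G ->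
  fv_assn P `<=` A1 `|` A2 ->
  (forall m, m < n -> valid m G A1 (AAnd P (ABool B)) C1 Q) ->
  (forall m, m < n -> valid m G A2 (AAnd P (ANot (ABool B))) C2 Q) ->
  valid n G (A1 `|` A2) P (If B C1 C2) Q.
Proof.
move=> Gok PA; elim: n => // n IH V1 V2 s h p gd sP; apply/safeS => //; split=> //.
- by move=> H; inversion H.
- move=> hG d sG C' s' k p' H; have gd' := good_pstep H gd.
  move: H gd' => /pstep_ifE[-> -> -> ->] gd'; exists h, hG; split=> //.
  case: ifP gd' => sB gd'.
    apply: (@safe_weaken _ _ _ _ _ G _ Q _ A1) => //.
    exact: V1.
  apply: (@safe_weaken _ _ _ _ _ G _ Q _ A2) => //.
  by apply: V2 => //; split=> //=; rewrite sB.
- move=> hG hG' s' p' er *; apply: IH.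
  + by move=> m mn; apply: V1; apply: leqW.
  + by move=> m mn; apply: V2; apply: leqW.
  + exact: good_env er gd.
  + by case: er => _ _ E _ _; apply: sat_agree sP => x Px; apply: E; left; apply: PA.
Qed.

Lemma valid_while n B C G P A : ctx_ok Loc G -> fv_assn P `<=` A ->
  fv_bexpr B `<=` A ->
  (forall m, valid m G A (AAnd P (ABool B)) C P) ->
  valid n G A P (While B C) (AAnd P (ANot (ABool B))).
Proof.
move=> Gok PA BA V; elim/ltn_ind: n => -[//|n] IH s h p gd sP.
apply/safeS => //; split=> //.
- by move=> H; inversion H.
- move=> hG d sG C' s' k p' H; have gd' := good_pstep H gd.
  move: H gd' => /pstep_whileE[-> -> -> ->] gd'; exists h, hG; split=> //.
  rewrite -[A]setUid; apply: valid_if gd' sP => //; first by rewrite setUid.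
    move=> m mn s1 h1 p1 gd1 sP1; rewrite -[A]setUid.
    apply: safe_seq => //; last first.
      (* Unfolding the loop has lowered the index, so the induction hypothesis covers the next
         round. *)
      by move=> m' m'm; apply: IH; rewrite ltnS (leq_trans m'm) // ltnW.
    apply: V => //; case: gd1 => ok [wC _] Ol dom.
    by split.
  move=> m mn s1 h1 p1 gd1 sP1; apply: safe_skip => // x [/PA|/BA] //.
- move=> hG hG' s' p' er *; apply: IH => //; first exact: good_env er gd.
  by case: er => _ _ E _ _; apply: sat_agree sP => x Px; apply: E; left; apply: PA.
Qed.

Lemma safe_frame n C s h hR p G Q R A : ctx_ok Loc G -> rconf_ok p ->
  safe n C s h p G Q A -> heap_disj h hR -> sat s hR R ->
  mod_cmd C `&` fv_assn R = set0 ->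
  safe n C s (heap_union h hR) p G (AStar Q R) (A `|` fv_assn R).
Proof.
move=> Gok; elim: n C s h p => // n IH C s h p ok.
move=> /(safeS _ _ _ _ _ _ _ Gok)[H1 H2 H3 H4 H5] dR sR CR; apply/safeS => //.
have {}CR := (set0_disj _ _).1 CR.
split=> //.
- by move=> /H1 sQ; apply: sat_star.
- by move=> /pabort_mono.
- move=> hG d sG C' s' k p' H; have [ok' _ _] := pstep_rconf H ok.
  (* Regrouped so that [hR] is the passive part: locality then gives a step on [h] and [hG] alone,
     to which the safety of [C] applies. *)
  have {}H : pstep C s (heap_union (heap_union h hG) hR) p C' s' k p'.
    by move: H; congr pstep; heaps.
  have [||k' [dk -> H']] := pstep_frame H ok; [heaps|by move=> /pabort_mono|].
  have d0 : heap_disj h hG by heaps.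
  have [h' [hG' [d' E sG' S]]] := H4 hG d0 sG _ _ _ _ H'.
  subst k'; exists (heap_union h' hR), hG'; split=> //; [heaps|heaps|].
  apply: IH => //; [heaps| |].
    apply: sat_agree sR => x Rx; rewrite (pstep_chng H) // => /chng_mod Cx.
    exact: CR Rx.
  by apply/set0_disj => x /(pstep_mod H) Cx; exact: CR.
- move=> hG hG' s' p' er d d' sG sG'; apply: IH => //.
  + by case: er.
  + apply: (H5 hG hG'); [|heaps|heaps|by []|by []].
    by apply: env_rel_sub er => x [Ax|Ax]; [left; left|right].
  + by case: er => _ _ E _ _; apply: sat_agree sR => x Rx; apply: E; left; right.
  + by apply/set0_disj.
Qed.

Lemma safe_conj n C s h p G Q1 Q2 A1 A2 : ctx_ok Loc G ->
  safe n C s h p G Q1 A1 -> safe n C s h p G Q2 A2 ->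
  safe n C s h p G (AAnd Q1 Q2) (A1 `|` A2).
Proof.
move=> Gok; elim: n C s h p => // n IH C s h p.
move=> /(safeS _ _ _ _ _ _ _ Gok)[H1 H2 H3 H4 H5].
move=> /(safeS _ _ _ _ _ _ _ Gok)[J1 J2 J3 J4 J5]; apply/safeS => //.
split=> //.
- by move=> E; split; [exact: H1|exact: J1].
- move=> hG d sG C' s' k p' H.
  have [h' [hG' [d' E' sG' S']]] := H4 _ d sG _ _ _ _ H.
  have [h1 [hG1 [d1 E1 sG1 S1]]] := J4 _ d sG _ _ _ _ H.
  have [E2 _] : h1 = h' /\ hG1 = hG' by apply: split_unique sG1 sG'; rewrite -?E1.
  by exists h', hG'; split=> //; apply: IH => //; rewrite -E2.
- move=> hG hG' s' p' er *; apply: IH.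
  + by apply: (H5 hG hG') => //; apply: env_rel_sub er => x [|]; [left; left|right].
  + by apply: (J5 hG hG') => //; apply: env_rel_sub er => x [|]; [left; right|right].
Qed.

End Rules.

(** * Parallel composition *)

Section ParallelRule.
Context (Var Res : eqType) (Loc : pred nat).
Implicit Types (s : store Var) (h hG hR : heap Loc) (C : cmd Var Res)
  (p : rconf Res) (G : ctx Var Res) (P Q R : assn Var) (A X : set Var)
  (q r : Res).

Lemma good_parC G C1 C2 p : good G (Par C1 C2) p -> good G (Par C2 C1) p.
Proof.
move=> [ok [w1 w2 dj] Ol dom]; split=> //; first by split=> // q l2 l1; exact: dj l1 l2.
by move=> q; move: (Ol q); setprop; tauto.
Qed.

Lemma good_hide G C1 C2 p :
  good G (Par C1 C2) p -> good G C1 (hide_res (locked C2) p).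
Proof.
move=> [ok [w1 w2 dj] Ol dom].
have Kp q : locked C2 q -> rO p q by move=> l2; apply/Ol; right.
split=> //; first exact: hide_res_ok.
  by move=> q; move: (Ol q) (dj q); setprop; tauto.
by move=> q; rewrite -dom; exact: hide_res_dom.
Qed.

(** The store part of the environment transition seen by [C2] has two sources: [C1] modifies nothing
    in [A2], and by clause (iii) it changes no variable protected by a lock of [C2], since such a
    lock lies in the L that [C1] sees. *)
Lemma par_step n C1 C2 s h1 h2 hG p G Q1 Q2 A1 A2 C1' s' k p' :
  ctx_ok Loc G -> good G (Par C1 C2) p -> heap_disj h1 h2 ->
  heap_disj (heap_union h1 h2) hG -> mod_cmd C1 `&` A2 = set0 ->
  safe n.+1 C1 s h1 (hide_res (locked C2) p) G Q1 A1 ->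
  safe n.+1 C2 s h2 (hide_res (locked C1) p) G Q2 A2 ->
  sat s hG (inv_star G (rD p)) ->
  pstep C1 s (heap_union (heap_union h1 h2) hG) p C1' s' k p' ->
  exists h1' hG', [/\ heap_disj h1' h2 /\ heap_disj (heap_union h1' h2) hG',
    k = heap_union (heap_union h1' h2) hG',
    sat s' hG' (inv_star G (rD p')),
    safe n C1' s' h1' (hide_res (locked C2) p') G Q1 A1 &
    safe n C2 s' h2 (hide_res (locked C1') p') G Q2 A2].
Proof.
move=> Gok gd d12 dG /set0_disj m1 /(safeS _ _ _ _ _ _ _ Gok)[_ na1 c1 st1 _].
move=> /(safeS _ _ _ _ _ _ _ Gok)[_ _ _ _ en2] sG H.
have gd' : good G (Par C1' C2) p' by apply: good_pstep gd; apply: pstep_P1 H.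
have [ok [w1 w2 dj] Ol dom] := gd; have [ok' [w1' _ dj'] Ol' dom'] := gd'.
have Kp q : locked C2 q -> rO p q by move=> l2; apply/Ol; right.
have {}H : pstep C1 s (heap_union (heap_union h1 hG) h2) p C1' s' k p'.
  by move: H; congr pstep; heaps.
have [|Hh _] := pstep_hide H ok Kp; first by move=> /pabort_mono/pabort_mono.
have [||k' [dk Ek H1]] := pstep_frame Hh (hide_res_ok ok Kp); [heaps| |].
  by move=> /pabort_mono.
have d1 : heap_disj h1 hG by heaps.
have [h1' [hG' [d' Ek' sG' S]]] := st1 hG d1 sG _ _ _ _ H1.
subst k k'; exists h1', hG'; split=> //; [by split; heaps|heaps|].
apply: (en2 hG hG') => //; [|heaps|heaps].
have [_ EL EOD] := pstep_rconf H ok.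
have Kp1 q : locked C1 q -> rO p q by move=> l1; apply/Ol; left.
have Kp1' q : locked C1' q -> rO p' q by move=> l1; apply/Ol'; left.
split; [exact: hide_res_ok|exact: hide_res_ok| | |].
- move=> x [A2x|[r l2 rx]]; symmetry; apply: (pstep_chng H) => Cx.
    by apply: m1 A2x; apply: chng_mod.
  by apply: (c1 x r Cx) rx; left; right.
(* In the view of [C2], O is exactly the set of its own locks, before and after the step. *)
- apply/seteqP; split=> q; move: (Ol q) (Ol' q) (dj q) (dj' q); setprop; tauto.
(* In that view an acquisition by [C1] moves a name from D to L and a release moves it back, so
   their union is constant. *)
- rewrite /= EL; move/rconf_okP: ok => ok; move/rconf_okP: ok' => ok'.
  apply/seteqP; split=> q; move: (Ol q) (Ol' q) (dj q) (dj' q) (EOD q);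
  case: (ok q) (ok' q) => ? ? ? [? ? ?]; setprop; tauto.
Qed.

Lemma env_rel_hide (K : set Res) A A' s p s' p' : A' `<=` A ->
  (forall q, K q -> rO p q) ->
  env_rel A s p s' p' -> env_rel A' s (hide_res K p) s' (hide_res K p').
Proof.
move=> AA Kp [ok ok' E EO ELD]; split=> /=.
- exact: hide_res_ok.
- by apply: hide_res_ok => //; rewrite EO.
- by move=> x /AA/E.
- by rewrite EO.
- by rewrite -!setUA (setUC K) setUA ELD -!setUA (setUC K).
Qed.

Lemma safe_par n C1 C2 s h1 h2 p G Q1 Q2 A1 A2 : ctx_ok Loc G ->
  fv_assn Q1 `<=` A1 -> fv_assn Q2 `<=` A2 ->
  good G (Par C1 C2) p -> heap_disj h1 h2 ->
  mod_cmd C1 `&` A2 = set0 -> mod_cmd C2 `&` A1 = set0 ->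
  safe n C1 s h1 (hide_res (locked C2) p) G Q1 A1 ->
  safe n C2 s h2 (hide_res (locked C1) p) G Q2 A2 ->
  safe n (Par C1 C2) s (heap_union h1 h2) p G (AStar Q1 Q2) (A1 `|` A2).
Proof.
move=> Gok QA1 QA2.
elim: n C1 C2 s h1 h2 p => // n IH C1 C2 s h1 h2 p gd d m1 m2 S1 S2.
have [q1 na1 ch1 _ en1] := (safeS _ _ _ _ _ _ _ Gok).1 S1.
have [q2 na2 ch2 _ en2] := (safeS _ _ _ _ _ _ _ Gok).1 S2.
have [ok [w1 w2 dj] Ol dom] := gd.
have Kp1 q : locked C1 q -> rO p q by move=> l1; apply/Ol; left.
have Kp2 q : locked C2 q -> rO p q by move=> l2; apply/Ol; right.
apply/safeS => //; split=> //.
- move=> H; inversion H; subst.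
    by apply: na1; apply: pabort_hide => //; apply: pabort_mono; eassumption.
  apply: na2; apply: pabort_hide => //; apply: (@pabort_mono _ _ _ _ _ _ h1).
  by rewrite heap_unionC // heap_disjC.
- move=> x r /= [Cx|Cx] LD; [apply: (ch1 x r Cx)|apply: (ch2 x r Cx)];
  by case: LD => ?; [left; left|right].
- move=> hG dG sG C' s' k p' H; have gd' := good_pstep H gd.
  case/pstep_parE: H gd' => [[C1' -> H]|[C2' -> H]|[E1 E2 [-> -> -> ->]]] gd'.
  + have [h1' [hG' [[d1 d2] -> sG' S1' S2']]] := par_step Gok gd d dG m1 S1 S2 sG H.
    exists (heap_union h1' h2), hG'; split=> //; apply: IH => //.
    by apply/set0_disj => x /(pstep_mod H); move/set0_disj: m1; apply.
  + have d' : heap_disj h2 h1 by rewrite heap_disjC.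
    rewrite (heap_unionC d) in dG H.
    have [h2' [hG' [[d1 d2] -> sG' S2' S1']]] :=
      par_step Gok (good_parC gd) d' dG m2 S2 S1 sG H.
    rewrite heap_disjC in d1.
    exists (heap_union h1 h2'), hG'; split=> //; [heaps|heaps|].
    apply: IH => //.
    by apply/set0_disj => x /(pstep_mod H); move/set0_disj: m2; apply.
  + exists (heap_union h1 h2), hG; split=> //; apply: safe_skip => //.
      by move=> x [/QA1|/QA2]; [left|right].
    by apply: sat_star => //; auto.
- move=> hG hG' s' p' er dG dG' sG sG'; apply: IH => //.
  + exact: good_env er gd.
  + apply: (en1 hG hG') => //; [|heaps|heaps].
    apply: env_rel_hide er => // x [Ax|[r lr rx]]; first by left; left.
    by right; exists r => //; left.
  + apply: (en2 hG hG') => //; [|heaps|heaps].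
    apply: env_rel_hide er => // x [Ax|[r lr rx]]; first by left; right.
    by right; exists r => //; right.
Qed.

End ParallelRule.

(** * Critical regions and local resources *)

Section ResourceRules.
Context (Var Res : eqType) (Loc : pred nat).
Implicit Types (s : store Var) (h hG hR : heap Loc) (C : cmd Var Res)
  (p : rconf Res) (G : ctx Var Res) (P Q R : assn Var) (A X : set Var)
  (q r : Res).

(** [D] and [D'] may differ at [r]: since [G] does not declare [r], [inv_star G] cannot see the
    difference. *)
Lemma inv_star_drop r X R G (D D' : set Res) :
  ~ D r -> (forall q, q <> r -> (D q <-> D' q)) ->
  ~ res_ctx G r ->
  inv_star (RDecl r X R :: G) D = inv_star G D'.
Proof.
move=> nD E nG; rewrite inv_star_cons /= memNset //.
by apply: inv_star_eqD => q Gq; apply: E => qr; apply: nG; rewrite -qr.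
Qed.

Lemma inv_star_take r X R G (D D' : set Res) :
  D r -> (forall q, q <> r -> (D q <-> D' q)) ->
  ~ res_ctx G r ->
  inv_star (RDecl r X R :: G) D = AStar R (inv_star G D').
Proof.
move=> Dr E nG; rewrite inv_star_cons /= mem_set //; congr AStar.
by apply: inv_star_eqD => q Gq; apply: E => qr; apply: nG; rewrite -qr.
Qed.

(** Inside the region the heap of [R] is private and the variables [X] are out of reach of the
    environment, so the body is judged in the context without [r] and with [A] enlarged by [X]. *)
Lemma safe_within n r X R C s h p G Q A :
  ctx_ok Loc (RDecl r X R :: G) -> fv_assn Q `<=` A ->
  good G C p -> safe n C s h p G (AStar Q R) (A `|` X) ->
  safe n (Within r C) s h (RConf (r |` rO p) (rL p) (rD p))
       (RDecl r X R :: G) Q A.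
Proof.
move=> Gok' QA; have /= [nG _ _ Gok] := ctx_ok_cons Gok'.
elim: n C s h p => // n IH C s h p gd.
have [okp w Ol dom] := gd.
have np : ~ rconf_dom p r by move=> /dom.
have pvr q : q <> r -> pv (RDecl r X R :: G) q = pv G q.
  by move=> qr; rewrite pv_cons /=; case: eqP => // E; case: qr.
move=> /(safeS _ _ _ _ _ _ _ Gok)[H1 H2 H3 H4 H5]; apply/safeS => //=; split=> //.
- case: p np okp {gd dom IH Ol} H2 H3 H4 H5 => O L D np okp H2 H3 H4 H5 H.
  inversion H; subst; last by match goal with N : ~ rO _ _ |- _ => apply: N; left end.
  apply: H2; match goal with N : pabort _ _ _ _ |- _ => move: N end.
  congr pabort; apply: rconf_eq => q; move: np; setprop.
  by have [E|?] := EM (q = r); try subst; split; tauto.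
- move=> x q Cx LD; rewrite pvr; first exact: H3 Cx LD.
  by move=> E; apply: np; rewrite -E; move: LD; setprop; tauto.
- have nD : ~ rD p r by move=> Dr; apply: np; right.
  move=> hG d sG C' s' k p' /pstep_withinE[_ []].
    case=> E -> -> -> ->; have := H1 E; case=> h1 [h2 [d12 Eh sQ sR]].
    (* On exit [h2], which satisfies [R], joins the shared heap, and [r] becomes available. *)
    exists h1, (heap_union h2 hG); split; [heaps|heaps| |exact: safe_skip].
    rewrite (@inv_star_take r X R G _ (rD p)) //=; last 2 first.
    + by left.
    + by move=> q qr; setprop; tauto.
    apply: sat_star => //; first by heaps.
    by move: sG; rewrite (@inv_star_drop r X R G _ (rD p)).
  case=> C1 [p1 [-> H ->]] /=.
  have {}H : pstep C s (heap_union h hG) p C1 s' k p1.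
    move: H; congr pstep; apply: rconf_eq => q; move: np; setprop.
    by have [E|?] := EM (q = r); try subst; split; tauto.
  have gd1 := good_pstep H gd; have [_ _ _ dom1] := gd1.
  have nD1 : ~ rD p1 r by move=> Dr; apply: nG; apply/dom1; right.
  rewrite (@inv_star_drop r X R G _ (rD p)) // in sG.
  have [h' [hG' [d' -> sG' S]]] := H4 _ d sG _ _ _ _ H.
  exists h', hG'; split=> //; last exact: IH.
  by rewrite (@inv_star_drop r X R G _ (rD p1)).
- move=> hG hG' s' p' er d d' sG sG'.
  have nD : ~ rD p r by move=> Dr; apply: np; right.
  have [_ /rconf_okP ok' _ /= EO _] := er.
  have nD' : ~ rD p' r.
    by move=> Dr; case: (ok' r) => _ + _; apply; rewrite EO; split=> //; left.
  have Ep : p' = RConf (r |` rO (RConf (rO p) (rL p') (rD p'))) (rL p') (rD p').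
    by case: p' EO {er ok' nD' sG'} => O L D /= ->.
  have er' : env_rel (A `|` X `|` lockpv G C) s p s' (RConf (rO p) (rL p') (rD p')).
    case: er => ok0 ok1 E _ ELD; split=> //.
    + rewrite Ep in ok1; move/rconf_okP: ok1 => ok1; apply/rconf_okP => q.
      by move: (ok1 q); setprop; case=> *; split; tauto.
    + move=> x [[Ax|Xx]|[q lq qx]]; apply: E; first by left.
        (* [Within r] locks [r], so the environment has to respect its protected variables [X]. *)
        by right; exists r; [left|rewrite pv_cons /= eqxx].
      right; exists q; first by right.
      by rewrite pvr // => qr; apply: nG; apply/dom; rewrite -qr; left; left; apply/Ol.
  rewrite Ep; apply: (IH C s' h (RConf (rO p) (rL p') (rD p'))).
    exact: good_env er' gd.
  apply: (H5 hG hG') => //.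
    by move: sG; rewrite (@inv_star_drop r X R G _ (rD p)).
  by move: sG'; rewrite (@inv_star_drop r X R G _ (rD p')).
Qed.

Lemma valid_with n r X R B C G P Q A :
  ctx_ok Loc (RDecl r X R :: G) -> fv_assn P `<=` A -> fv_assn Q `<=` A ->
  unextended C ->
  (forall m, valid Loc m G (A `|` X) (AStar (AAnd P (ABool B)) R) C (AStar Q R)) ->
  valid Loc n (RDecl r X R :: G) A P (With r B C) Q.
Proof.
move=> Gok' PA QA u V; have /= [nG _ _ Gok] := ctx_ok_cons Gok'.
elim: n => // n IH s h p gd sP; apply/safeS => //; split=> //.
- case: gd => _ _ _ dom H; inversion H; subst.
  by match goal with N : ~ _ |- _ => apply: N; apply/dom end; rewrite /res_ctx /= inE eqxx.
- move=> hG d sG C' s' k p' /pstep_withE[[-> -> ->] [Dr sB ->]].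
  (* Acquiring [r] moves the heap of [R] from the shared part to the private part. *)
  move: sG; rewrite (@inv_star_take r X R G _ (rD p `\ r)) //; last first.
    by move=> q qr; setprop; tauto.
  case=> h1 [h2 [d12 E sR sG]]; subst hG.
  exists (heap_union h h1), h2; split; [heaps|heaps| |].
    rewrite (@inv_star_drop r X R G _ (rD p `\ r)) //=; by setprop; tauto.
  have gdC : good G C (RConf (rO p) (rL p) (rD p `\ r)).
    case: gd => /rconf_okP ok w Ol dom; have [wC N] := unextended_wfc u.
    split=> //.
    - by apply/rconf_okP => q; case: (ok q); setprop => *; split; tauto.
    - by move=> q; rewrite (Ol q); split=> // /N.
    - move=> q; have := dom q; have [_ OD LD] := ok r; rewrite /res_ctx /= inE.
      have [E|/eqP qr] := EM (q = r).
        subst q => _; split=> [|/nG //]; move: OD LD; setprop; tauto.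
      by rewrite (negbTE qr) /= => <-; move/eqP: qr; setprop; tauto.
  apply: (safe_within Gok' QA gdC); apply: V => //.
  by apply: sat_star => //; heaps.
- move=> hG hG' s' p' er *; apply: IH => //; first exact: good_env er gd.
  by case: er => _ _ E _ _; apply: sat_agree sP => x Px; apply: E; left; apply: PA.
Qed.

(* The part of the invariant of r that the heap of [Resource r C] contains
   beyond the heap of C. *)
Definition held r R C : assn Var := if `[< locked C r >] then AEmp else R.

Lemma good_enter r X R C p G : ~ res_ctx G r ->
  good G (Resource r C) p -> good (RDecl r X R :: G) C (enter r C p).
Proof.
move=> nG [ok w Ol dom]; have np : ~ rconf_dom p r by move/dom.
case: p np ok Ol dom => O L D np ok Ol dom; rewrite /enter.
case: asboolP => lr; split=> //.
- exact: rconf_okRO.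
- move=> q; move: (Ol q) np; setprop.
  by have [E|?] := EM (q = r); try subst; tauto.
- move=> q; have := dom q; rewrite /res_ctx /= inE.
  have [E|qr] := EM (q = r).
    by subst q => _; rewrite eqxx /=; split=> // _; left; left; left.
  by move/eqP: (qr) => /negbTE -> /= <-; setprop; tauto.
- exact: rconf_okRD.
- move=> q; move: (Ol q) np; setprop.
  by have [E|?] := EM (q = r); try subst; tauto.
- move=> q; have := dom q; rewrite /res_ctx /= inE.
  have [E|qr] := EM (q = r).
    by subst q => _; rewrite eqxx /=; split=> // _; right; left.
  by move/eqP: (qr) => /negbTE -> /= <-; setprop; tauto.
Qed.

(** In a [good] configuration O equals the set of locks of [C], so a declared [r] outside L is in O
    or D according to [locked C r], and [enter] can put it back where it was. *)
Lemma enter_del r X R C p G : good (RDecl r X R :: G) C p -> ~ rL p r ->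
  enter r C (rconf_del p r) = p.
Proof.
move=> [/rconf_okP ok _ Ol dom] nL.
have {dom} : rconf_dom p r by apply/dom; rewrite /res_ctx /= inE eqxx.
move: (Ol r) (ok r) => Olr [okr1 okr2 okr3] dom; rewrite /enter.
case: asboolP => lr; apply: rconf_eq => q; move: dom; setprop;
have [E|?] := EM (q = r); try subst; split; tauto.
Qed.

(** From outside, [hr] is private to the block; from inside, it is the shared heap of [r], empty
    while [C] locks [r]. [sat_inv_leave] is the passage back after a step of the body. *)
Lemma sat_inv_enter r X R C s hr hG p G : ~ res_ctx G r -> ~ rconf_dom p r ->
  heap_disj hr hG -> sat s hr (held r R C) -> sat s hG (inv_star G (rD p)) ->
  sat s (heap_union hr hG) (inv_star (RDecl r X R :: G) (rD (enter r C p))).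
Proof.
move=> nG np d; rewrite /held /enter; case: asboolP => lr /= sr sG.
  rewrite sr in d *; rewrite (@inv_star_drop r X R G _ (rD p)) //.
    by rewrite (_ : heap_union _ hG = hG) //; heaps.
  by move=> Dr; apply: np; right.
rewrite (@inv_star_take r X R G _ (rD p)) //=.
- exact: sat_star.
- by left.
- by move=> q qr; setprop; tauto.
Qed.

Lemma sat_inv_leave r X R C s k p G : ~ res_ctx G r ->
  good (RDecl r X R :: G) C p -> ~ rL p r ->
  sat s k (inv_star (RDecl r X R :: G) (rD p)) ->
  exists hr hG, [/\ heap_disj hr hG, k = heap_union hr hG,
    sat s hr (held r R C) & sat s hG (inv_star G (rD (rconf_del p r)))].
Proof.
move=> nG [/rconf_okP ok _ Ol dom] nL.
have {dom} : rconf_dom p r by apply/dom; rewrite /res_ctx /= inE eqxx.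
move: (Ol r) (ok r) => Olr [okr1 okr2 okr3] dom; rewrite /held.
case: asboolP => lr.
  rewrite (@inv_star_drop r X R G _ (rD (rconf_del p r))) //; first last.
  - by move=> q qr; setprop; tauto.
  - by move: dom; setprop; tauto.
  by move=> sk; exists [fmap]%fmap, k; split=> //; heaps.
rewrite (@inv_star_take r X R G _ (rD (rconf_del p r))) //.
- by move: dom; setprop; tauto.
- by move=> q qr; setprop; tauto.
Qed.

(** From outside [X] is always preserved, while from inside it must be preserved only if [C] locks
    [r], so the inner requirement on stores is weaker. [enter] adds [r] to the same component on
    both sides. *)
Lemma env_rel_enter r X R C A s p s' p' G : ~ rconf_dom p r ->
  env_rel (A `|` X `|` lockpv G (Resource r C)) s p s' p' ->
  env_rel (A `|` lockpv (RDecl r X R :: G) C) s (enter r C p) s' (enter r C p').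
Proof.
move=> np [ok ok' E EO ELD].
have ELDq q : rL p' q \/ rD p' q <-> rL p q \/ rD p q.
  by move: (congr1 (@^~ q) ELD); setprop => ->.
have np' : ~ rconf_dom p' r.
  by move: (ELDq r) np; setprop; rewrite EO; tauto.
split.
- by rewrite /enter; case: asboolP => _; case: p ok np {EO ELD ELDq} => *;
    [exact: rconf_okRO|exact: rconf_okRD].
- by rewrite /enter; case: asboolP => _; case: p' ok' np' {EO ELD ELDq} => *;
    [exact: rconf_okRO|exact: rconf_okRD].
- move=> x [Ax|[q lq]]; first by apply: E; left; left.
  rewrite pv_cons /=; case: eqP => [_ Xx|rq qx]; apply: E; first by left; right.
  by right; exists q => //; split=> // qr; apply: rq.
- by rewrite /enter; case: asboolP => _ /=; rewrite EO.
- rewrite /enter; case: asboolP => _ //=.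
  by rewrite setUCA ELD setUCA.
Qed.

Lemma safe_resource n r X R C s h hr p G Q A :
  ctx_ok Loc (RDecl r X R :: G) -> fv_assn Q `<=` A ->
  good G (Resource r C) p -> heap_disj h hr -> sat s hr (held r R C) ->
  safe n C s h (enter r C p) (RDecl r X R :: G) Q A ->
  safe n (Resource r C) s (heap_union h hr) p G (AStar Q R) (A `|` X).
Proof.
move=> Gok' QA; have /= [nG _ RX Gok] := ctx_ok_cons Gok'.
elim: n C s h hr p => // n IH C s h hr p gd dr sr.
move=> /(safeS _ _ _ _ _ _ _ Gok')[H1 H2 H3 H4 H5].
have [ok w Ol dom] := gd.
have np : ~ rconf_dom p r by move=> /dom.
apply/safeS => //=; split=> //.
- by move=> /pabort_resourceE/(_ np)/pabort_mono.
- move=> x q Cx LD qx.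
  have qr : q <> r by move=> E; apply: np; rewrite -E; move: LD; setprop; tauto.
  apply: (H3 x q Cx); last by rewrite pv_cons /=; case: eqP => // E; case: qr.
  by rewrite /enter; case: asboolP => _ //=; case: LD; [left|right; right].
- move=> hG dG sG C' s' k p' H; have gd' := good_pstep H gd.
  case/pstep_resourceE: H gd' => _ [[E -> -> -> ->]|[C1 [p1 [-> -> H]]]] gd'.
    exists (heap_union h hr), hG; split=> //; apply: safe_skip => //.
      by move=> x /= [/QA|/RX]; [left|right].
    apply: sat_star => //; first exact: H1.
    (* [Skip] locks nothing, so [hr] satisfies [R] when the block ends. *)
    by move: sr; rewrite /held E /= asboolF.
  have dG' : heap_disj h (heap_union hr hG) by heaps.
  have {}H : pstep C s (heap_union h (heap_union hr hG)) (enter r C p) C1 s' k p1.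
    by move: H; congr pstep; heaps.
  have gd1 := good_pstep H (good_enter X R nG gd).
  have nL1 : ~ rL p1 r.
    have [ok1 -> _] := pstep_rconf H (let: And4 a _ _ _ := good_enter X R nG gd in a).
    by move=> Lr; apply: np; move: Lr; rewrite /enter; case: asboolP => _; setprop; tauto.
  have d0 : heap_disj hr hG by heaps.
  have [h' [hG' [d' -> sG' S]]] := H4 _ dG' (sat_inv_enter X nG np d0 sr sG) _ _ _ _ H.
  have [hr' [hG1 [d1 E sr' sG1]]] := sat_inv_leave nG gd1 nL1 sG'.
  subst hG'; exists (heap_union h' hr'), hG1; split=> //; [heaps|heaps|].
  apply: IH => //; first heaps.
  by rewrite (enter_del gd1).
- move=> hG hG' s' p' er d d' sG sG'.
  have gd' := good_env er gd; have [_ _ _ dom'] := gd'.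
  have np' : ~ rconf_dom p' r by move=> /dom'.
  have sr' : sat s' hr (held r R C).
    move: sr; rewrite /held; case: asboolP => // _; apply: sat_agree => x Rx.
    by case: er => _ _ E _ _; apply: E; left; right; apply: RX.
  apply: IH => //; apply: (H5 (heap_union hr hG) (heap_union hr hG')).
  + exact: env_rel_enter er.
  + heaps.
  + heaps.
  + by apply: sat_inv_enter => //; heaps.
  + by apply: sat_inv_enter => //; heaps.
Qed.

End ResourceRules.

(** * Renaming *)

Section Renaming.
Context (Var Res : eqType) (Loc : pred nat).
Context (f : Res -> Res) (fK : involutive f).
Implicit Types (s : store Var) (h : heap Loc) (C : cmd Var Res)
  (p : rconf Res) (G : ctx Var Res) (P Q : assn Var) (A : set Var)
  (D : set Res) (q r : Res).

(** Equivariance is proved for an arbitrary involution because [ren_res r r'] is not injective when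
    [r] and [r'] differ. An involution also makes each transport lemma serve as its own converse. *)
Fixpoint map_cmd C : cmd Var Res :=
  match C with
  | Skip => Skip
  | Basic c => Basic c
  | Seq C1 C2 => Seq (map_cmd C1) (map_cmd C2)
  | If B C1 C2 => If B (map_cmd C1) (map_cmd C2)
  | While B C1 => While B (map_cmd C1)
  | Resource q C1 => Resource (f q) (map_cmd C1)
  | With q B C1 => With (f q) B (map_cmd C1)
  | Within q C1 => Within (f q) (map_cmd C1)
  | Par C1 C2 => Par (map_cmd C1) (map_cmd C2)
  end.

(* [f] being an involution, the image of a set is its preimage. *)
Definition map_rconf p : rconf Res :=
  RConf (f @^-1` rO p) (f @^-1` rL p) (f @^-1` rD p).

Definition map_ctx G : ctx Var Res :=
  [seq RDecl (f (rname d)) (rvars d) (rinv d) | d <- G].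

Lemma map_cmdK : involutive map_cmd.
Proof.
by elim=> //= [C -> C' ->|B C -> C' ->|B C ->|r C ->|r B C ->|r C ->
  |C -> C' ->] //; rewrite fK.
Qed.

Lemma map_rconfK : involutive map_rconf.
Proof. by case=> O L D; apply: rconf_eq => q; rewrite /preimage /mkset /= fK. Qed.

Lemma map_ctxK : involutive map_ctx.
Proof. by elim=> //= -[r X R] G ->; rewrite fK. Qed.

Lemma locked_map C q : locked (map_cmd C) q <-> locked C (f q).
Proof.
have fE r : (q = f r) <-> (f q = r) by split=> [->|<-]; rewrite fK.
elim: C => //=; setprop; intros; rewrite ?fE; tauto.
Qed.

Lemma unextended_map C : unextended (map_cmd C) = unextended C.
Proof. by elim: C => //= [C -> C' ->|B C -> C' ->|C -> C' ->]. Qed.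

Lemma wfc_map C : wfc C -> wfc (map_cmd C).
Proof.
elim: C => //= [C IH C' _ [/IH w u]|B C _ C' _|B C _|r B C _|r C IH [/IH w nl]
  |C IH C' IH' [/IH w /IH' w' dj]]; rewrite ?unextended_map //; split=> //.
  by move=> /locked_map; rewrite fK.
by move=> q /locked_map l /locked_map; exact: dj l.
Qed.

Lemma chng_map C : chng (map_cmd C) = chng C.
Proof. by elim: C => //= C -> C' ->. Qed.

Lemma map_rconfO r (O L D : set Res) :
  map_rconf (RConf (r |` O) L D) =
  RConf (f r |` f @^-1` O) (f @^-1` L) (f @^-1` D).
Proof.
apply: rconf_eq => q; setprop; rewrite /preimage /mkset /=.
have fE : (q = f r) <-> (f q = r) by split=> [->|<-]; rewrite fK.
by split; tauto.
Qed.

Lemma map_rconfD r (O L D : set Res) :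
  map_rconf (RConf O L (r |` D)) =
  RConf (f @^-1` O) (f @^-1` L) (f r |` f @^-1` D).
Proof.
apply: rconf_eq => q; setprop; rewrite /preimage /mkset /=.
have fE : (q = f r) <-> (f q = r) by split=> [->|<-]; rewrite fK.
by split; tauto.
Qed.

Lemma preimage_del r (O : set Res) : f @^-1` (O `\ r) = (f @^-1` O) `\ f r.
Proof.
apply/seteqP; split=> q; setprop; rewrite /preimage /mkset /= => -[? N]; split=> // E;
by apply: N; first [rewrite E fK|rewrite -E fK].
Qed.

Lemma map_rconf_del p r :
  map_rconf (rconf_del p r) = rconf_del (map_rconf p) (f r).
Proof. by rewrite /map_rconf /= !preimage_del. Qed.

Lemma map_rconf_dom p r : rconf_dom (map_rconf p) (f r) <-> rconf_dom p r.
Proof. by setprop; rewrite /preimage /mkset /= fK. Qed.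

Lemma pstep_map C s h p C' s' h' p' : pstep C s h p C' s' h' p' ->
  pstep (map_cmd C) s h (map_rconf p) (map_cmd C') s' h' (map_rconf p').
Proof.
elim=> {C s h p C' s' h' p'} /=; try by move=> *; constructor.
- by move=> r s h p np; constructor; move/map_rconf_dom.
- move=> r C s h O L D C' s' h' p' np lr _ IH; rewrite map_rconf_del.
  apply: pstep_R1; [by move/(map_rconf_dom (RConf O L D))|by apply/locked_map; rewrite fK|].
  by rewrite -map_rconfO.
- move=> r C s h O L D C' s' h' p' np lr _ IH; rewrite map_rconf_del.
  apply: pstep_R2; [by move/(map_rconf_dom (RConf O L D))|by move/locked_map; rewrite fK|].
  by rewrite -map_rconfD.
- move=> r B C s h O L D Dr sB; rewrite map_rconfO preimage_del.
  by apply: pstep_W0 => //; rewrite /preimage /mkset /= fK.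
- move=> r C s h O L D C' s' h' O' L' D' Or _ IH; rewrite map_rconfO.
  apply: pstep_W1; first by rewrite /preimage /mkset /= fK.
  by rewrite -preimage_del.
- move=> r s h O L D Or; rewrite map_rconfD preimage_del.
  by apply: pstep_W2; rewrite /preimage /mkset /= fK.
Qed.

Lemma pabort_map C s h p :
  pabort C s h p -> pabort (map_cmd C) s h (map_rconf p).
Proof.
elim=> {C s h p} /=; try by move=> *; constructor.
- by move=> r C s h p pr; constructor; apply/map_rconf_dom.
- by move=> r B C s h p pr; constructor; move/map_rconf_dom.
- move=> r C s h O L D np lr _ IH.
  apply: pabort_RA1; [by move/(map_rconf_dom (RConf O L D))|by apply/locked_map; rewrite fK|].
  by rewrite -map_rconfO.
- move=> r C s h O L D np lr _ IH.
  apply: pabort_RA2; [by move/(map_rconf_dom (RConf O L D))|by move/locked_map; rewrite fK|].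
  by rewrite -map_rconfD.
- by move=> r C s h p _; rewrite map_rconf_del; exact: pabort_WA1.
- by move=> r C s h p nO; apply: pabort_WA2; rewrite /preimage /mkset /= fK.
Qed.

Lemma inv_star_map G D : inv_star (map_ctx G) (f @^-1` D) = inv_star G D.
Proof.
elim: G => [|d G IH]; first by rewrite /inv_star !big_nil.
rewrite /= !inv_star_cons IH /=.
suff -> : (f (rname d) \in f @^-1` D) = (rname d \in D) by [].
by apply/idP/idP; rewrite !in_setE /preimage /mkset /= fK.
Qed.

Lemma inv_star_map_rD G p :
  inv_star (map_ctx G) (rD p) = inv_star G (rD (map_rconf p)).
Proof. by rewrite -{1}[p]map_rconfK; exact: inv_star_map. Qed.

Lemma pv_map G q : pv (map_ctx G) q = pv G (f q).
Proof.
elim: G => //= d G IH; rewrite !pv_cons IH /=.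
by rewrite (can2_eq fK fK).
Qed.

Lemma res_ctx_map G q : res_ctx (map_ctx G) q <-> res_ctx G (f q).
Proof.
rewrite /res_ctx /=; elim: G => //= d G IH; rewrite !inE (eq_sym q) (can2_eq fK fK) eq_sym.
by split=> /orP[->//|/IH->]; rewrite ?orbT.
Qed.

Lemma ctx_ok_map G : ctx_ok Loc G -> ctx_ok Loc (map_ctx G).
Proof.
case=> u H; split.
  rewrite /map_ctx -map_comp (eq_map (g := f \o @rname Var Res)) // map_comp.
  by rewrite map_inj_uniq //; exact: inv_inj.
move=> r d E; suff [d' E' [-> ->]] : exists2 d', lookup G (f r) = Some d' &
    rinv d = rinv d' /\ rvars d = rvars d' by exact: H E'.
elim: G {u H} E => // d' G IH; rewrite /= !lookup_cons /= (can2_eq fK fK).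
by case: ifP => _; [case=> <-; exists d'|exact: IH].
Qed.

Lemma rconf_ok_map p : rconf_ok p -> rconf_ok (map_rconf p).
Proof. by move=> /rconf_okP ok; apply/rconf_okP => q; exact: (ok (f q)). Qed.

Lemma good_map G C p : good G C p -> good (map_ctx G) (map_cmd C) (map_rconf p).
Proof.
move=> [ok w Ol dom]; split.
- exact: rconf_ok_map.
- exact: wfc_map.
- by move=> q; rewrite locked_map; exact: Ol.
- by move=> q; rewrite res_ctx_map; exact: dom.
Qed.

Lemma lockpv_map G C : lockpv (map_ctx G) (map_cmd C) = lockpv G C.
Proof.
apply/seteqP; split=> x [q].
  by move=> /locked_map lq; rewrite pv_map => qx; exists (f q).
by move=> lq qx; exists (f q); [apply/locked_map|rewrite pv_map]; rewrite fK.
Qed.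

Lemma env_rel_map A s p s' p' : env_rel A s (map_rconf p) s' p' ->
  env_rel A s p s' (map_rconf p').
Proof.
move=> [ok ok' E EO ELD]; split=> //.
- by rewrite -[p]map_rconfK; exact: rconf_ok_map.
- exact: rconf_ok_map.
- by rewrite /= EO /=; apply/funext => q; rewrite /preimage /mkset /= fK.
- rewrite /= -preimage_setU ELD /=; apply/funext => q.
  by rewrite /preimage /setU /mkset /= fK.
Qed.

Lemma safe_map n C s h p G Q A : ctx_ok Loc G ->
  safe n C s h p G Q A ->
  safe n (map_cmd C) s h (map_rconf p) (map_ctx G) Q A.
Proof.
move=> Gok; elim: n C s h p => // n IH C s h p.
move=> /(safeS _ _ _ _ _ _ _ Gok)[H1 H2 H3 H4 H5].
apply/safeS; first exact: ctx_ok_map.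
split.
- by move=> E; apply: H1; rewrite -[C]map_cmdK E.
- by move=> /pabort_map; rewrite map_cmdK map_rconfK.
- by move=> x q; rewrite chng_map pv_map; exact: H3.
- move=> hG d sG C' s' k p' /pstep_map; rewrite map_cmdK map_rconfK => H.
  rewrite inv_star_map in sG.
  have [h' [hG' [d' -> sG' S]]] := H4 _ d sG _ _ _ _ H.
  exists h', hG'; split=> //; last by rewrite -[C']map_cmdK -[p']map_rconfK; exact: IH.
  by rewrite inv_star_map_rD.
- move=> hG hG' s' p'; rewrite lockpv_map => /env_rel_map er d d' sG sG'.
  rewrite -[p']map_rconfK; apply: IH; apply: (H5 hG hG') => //.
    by rewrite inv_star_map in sG.
  by rewrite inv_star_map_rD in sG'.
Qed.

(** The premise of the renaming rule concerns the renamed triple; mapping its safety by [f] once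
    more returns to the original. *)
Lemma valid_map n G A P C Q : ctx_ok Loc G ->
  valid Loc n (map_ctx G) A P (map_cmd C) Q -> valid Loc n G A P C Q.
Proof.
move=> Gok V s h p /good_map gd sP; rewrite -[C]map_cmdK -[p]map_rconfK -[G]map_ctxK.
by apply: safe_map; [exact: ctx_ok_map|exact: V].
Qed.

End Renaming.

Section Swap.
Context (Var Res : eqType).
Implicit Types (r q : Res) (C : cmd Var Res) (G : ctx Var Res).

Definition swap r r' q : Res := if q == r then r' else if q == r' then r else q.

Lemma swapK r r' : involutive (swap r r').
Proof.
move=> q; rewrite /swap; case: (eqVneq q r) => [->|qr].
  by rewrite eqxx; case: (eqVneq r' r).
case: (eqVneq q r') => [->|qr']; first by rewrite eqxx.
by rewrite (negbTE qr) (negbTE qr').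
Qed.

Lemma ren_res_swap r r' q : q <> r' -> ren_res r r' q = swap r r' q.
Proof. by move=> /eqP/negbTE; rewrite /ren_res /swap => ->. Qed.

(* Renaming r to a name that does not occur is a swap, hence invertible. *)
Lemma ren_cmd_swap r r' C : ~ res_cmd C r' ->
  ren_cmd r r' C = map_cmd (swap r r') C.
Proof.
elim: C => //= [C1 IH1 C2 IH2|B C1 IH1 C2 IH2|B C IH|q C IH|q B C IH|q C IH
  |C1 IH1 C2 IH2] N.
- by rewrite IH1 ?IH2 // => ?; apply: N; [right|left].
- by rewrite IH1 ?IH2 // => ?; apply: N; [right|left].
- by rewrite IH.
- by rewrite IH ?ren_res_swap // => ?; apply: N; [left|right].
- by rewrite IH ?ren_res_swap // => ?; apply: N; [left|right].
- by rewrite IH ?ren_res_swap // => ?; apply: N; [left|right].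
- by rewrite IH1 ?IH2 // => ?; apply: N; [right|left].
Qed.

Lemma ren_ctx_swap r r' G : ~ res_ctx G r' ->
  ren_ctx r r' G = map_ctx (swap r r') G.
Proof.
rewrite /res_ctx /=; elim: G => //= d G IH; rewrite inE => N.
rewrite IH; last by move=> Gr; apply: N; rewrite Gr orbT.
by rewrite ren_res_swap // => E; apply: N; rewrite E eqxx.
Qed.

Lemma unextended_ren r r' C : unextended (ren_cmd r r' C) = unextended C.
Proof. by elim: C => //= [C -> C' ->|B C -> C' ->|C -> C' ->]. Qed.

End Swap.

(** * Auxiliary variables *)

Section Auxiliary.
Context (Var Res : eqType) (Loc : pred nat) (X : set Var).
Implicit Types (s sc : store Var) (h hG : heap Loc) (C : cmd Var Res)
  (p : rconf Res) (G : ctx Var Res) (P Q : assn Var) (A : set Var)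
  (B : bexpr Var) (q r : Res).

Definition agree_off s sc := forall x, ~ X x -> s x = sc x.

Lemma unextended_erase C : unextended (erase X C) = unextended C.
Proof.
elim: C => //= [[] //= x e|C -> C' ->|B C -> C' ->|C -> C' ->] //.
by case: ifP.
Qed.

Lemma locked_erase C : locked (erase X C) = locked C.
Proof.
elim: C => //= [[] //= x e|r C ->|r C ->|C -> C' ->] //.
by case: ifP.
Qed.

Lemma chng_erase C x : chng (erase X C) x -> chng C x.
Proof.
elim: C => //= [[] //= y e|C IH C' IH']; first by case: ifP.
by case=> [/IH|/IH']; [left|right].
Qed.

Lemma enter_erase r C p : enter r (erase X C) p = enter r C p.
Proof. by rewrite /enter locked_erase. Qed.

(* A transition of the original program that erasure makes invisible: the
   execution of an assignment to an auxiliary variable. *)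
Definition silent h p C s C1 s1 : Prop :=
  [/\ pstep C s h p C1 s1 h p, erase X C1 = erase X C,
      auxiliary X C -> auxiliary X C1 & agree_off s s1].

Inductive silents h p : cmd Var Res -> store Var -> cmd Var Res -> store Var -> Prop :=
  | silents0 C s : silents h p C s C s
  | silentsS C s C1 s1 C2 s2 :
      silent h p C s C1 s1 -> silents h p C1 s1 C2 s2 -> silents h p C s C2 s2.

Lemma silents_erase h p C s C1 s1 : silents h p C s C1 s1 ->
  [/\ erase X C1 = erase X C, auxiliary X C -> auxiliary X C1 & agree_off s s1].
Proof.
elim=> // {}C {}s {}C1 {}s1 C2 s2 [_ E1 a1 g1] _ [E2 a2 g2]; split.
- by rewrite E2.
- by move=> /a1/a2.
- by move=> x Xx; rewrite g1 // g2.
Qed.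

Lemma silents_trans h p C s C1 s1 C2 s2 : silents h p C s C1 s1 ->
  silents h p C1 s1 C2 s2 -> silents h p C s C2 s2.
Proof. by elim=> // *; econstructor; eauto. Qed.

Lemma silents_lift (K : cmd Var Res -> cmd Var Res) h p p' C s C1 s1 :
  (forall C s C1 s1, silent h p C s C1 s1 -> silent h p' (K C) s (K C1) s1) ->
  silents h p C s C1 s1 -> silents h p' (K C) s (K C1) s1.
Proof.
move=> lift; elim=> [*|{}C {}s {}C1 {}s1 C2 s2 /lift H _]; first exact: silents0.
exact: silentsS.
Qed.

Lemma silent_seq C2 h p C s C1 s1 :
  silent h p C s C1 s1 -> silent h p (Seq C C2) s (Seq C1 C2) s1.
Proof.
move=> [H E a g]; split=> //=; [by constructor|by rewrite E|].
by move=> [? ?]; split; auto.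
Qed.

Lemma silent_parl C2 h p C s C1 s1 :
  silent h p C s C1 s1 -> silent h p (Par C C2) s (Par C1 C2) s1.
Proof.
move=> [H E a g]; split=> //=; [by constructor|by rewrite E|].
by move=> [? ?]; split; auto.
Qed.

Lemma silent_parr C2 h p C s C1 s1 :
  silent h p C s C1 s1 -> silent h p (Par C2 C) s (Par C2 C1) s1.
Proof.
move=> [H E a g]; split=> //=; [exact: pstep_P2|by rewrite E|].
by move=> [? ?]; split; auto.
Qed.

Lemma rconf_del_enter r C p : ~ rconf_dom p r -> rconf_del (enter r C p) r = p.
Proof.
move=> np; rewrite /enter; case: asboolP => _; apply: rconf_eq => q; move: np; setprop;
by have [E|?] := EM (q = r); try subst; split; tauto.
Qed.

(** [silents_lift] does not apply, as the inner configuration [enter r C p] depends on the command.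
    It stays constant because erasure preserves the set of locks and silent steps preserve the
    erasure. *)
Lemma silents_resource r h p C s C1 s1 : ~ rconf_dom p r ->
  silents h (enter r C p) C s C1 s1 ->
  silents h p (Resource r C) s (Resource r C1) s1.
Proof.
move=> np; move: {-1}(enter r C p) (erefl (enter r C p)) => p1 E H.
elim: H E => [*|{}C {}s C2 s2 C3 s3 [H EC a g] _ IH E]; first exact: silents0.
have E2 : enter r C2 p = p1 by rewrite -E -enter_erase EC enter_erase.
apply: silentsS (IH E2); split=> //=; last by rewrite EC.
by rewrite -{2}(rconf_del_enter C np); apply: pstep_enter np _; rewrite E.
Qed.

Lemma silent_within r h p C s C1 s1 : rO p r ->
  silent h (RConf (rO p `\ r) (rL p) (rD p)) C s C1 s1 ->
  silent h p (Within r C) s (Within r C1) s1.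
Proof.
move=> Or [H E a g]; split=> //=; last by rewrite E.
case: p Or H => O L D Or H; apply: pstep_conv (pstep_W1 Or H) _ _ => //.
by apply: rconf_eq => q; setprop; have [E1|?] := EM (q = r); try subst; split; tauto.
Qed.

(** Such a [C] is [Skip] or a single assignment to an auxiliary variable, so at most one silent step
    is taken. *)
Lemma silents_skip h p C s : erase X C = Skip -> exists s1, silents h p C s Skip s1.
Proof.
case: C => //= [_|[x e|x e|e e'|x e es|e]] //=; first by exists s; constructor.
case: ifP => // /set_mem Xx _; exists (update s x (eval s e)).
apply: silentsS (silents0 _ _ _ _); split=> //=.
- by constructor; constructor.
- by rewrite mem_set.
- by move=> y Xy; rewrite update_other //; apply/eqP => E; apply: Xy; rewrite E.
Qed.

Lemma beval_agree_off s sc B : fv_bexpr B `&` X = set0 -> agree_off s sc ->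
  beval s B = beval sc B.
Proof.
by move=> /set0_disj BX g; apply: beval_agree => x Bx; apply: g => Xx; exact: BX Xx.
Qed.

Lemma erase_basicE c C :
  erase X (Basic c) = C -> auxiliary X (Basic c : cmd Var Res) ->
  C = Skip \/ C = Basic c /\ fv_bcmd c `&` X = set0.
Proof.
case: c => [x e|x e|e e'|x e es|e] /= <-; try by right.
case: ifPn => [_|/negP nX]; first by left.
case=> [Xx|/set0_disj eX]; first by case: nX; rewrite mem_set.
right; split=> //; apply/set0_disj => y [-> Xx|]; last exact: eX.
by case: nX; rewrite mem_set.
Qed.

(** The aborting basic command or resource construct is also present and active in [C], so no silent
    step has to come first. *)
Lemma pabort_erase C s sc h p : pabort (erase X C) s h p -> auxiliary X C ->
  agree_off s sc -> pabort C sc h p.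
Proof.
elim: C p => [|c|C1 IH1 C2 IH2|B C1 IH1 C2 IH2|B C IH|r C IH|r B C IH|r C IH
  |C1 IH1 C2 IH2] p.
- by move=> H; inversion H.
- move=> H a g; have [E|[E cX]] := erase_basicE erefl a; rewrite E in H.
    by inversion H.
  by inversion H; subst; constructor; apply: babort_agree cX g.
- by move=> /= H [a1 a2] g; inversion H; subst; constructor; apply: IH1.
- by move=> /= H; inversion H.
- by move=> /= H; inversion H.
- move=> /= H a g; have [pr|np] := EM (rconf_dom p r); first by constructor.
  move: (pabort_resourceE H np); rewrite enter_erase => /IH/(_ a g).
  case: p np {H} => O L D np; rewrite /enter; case: asboolP => lr.
    exact: pabort_RA1.
  exact: pabort_RA2.
- by move=> /= H; inversion H; subst; move=> *; constructor.
- move=> /= H a g; inversion H; subst; last by apply: pabort_WA2.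
  by apply: pabort_WA1; apply: IH.
- move=> /= H [a1 a2] g; inversion H; subst.
    by apply: pabort_PA1; apply: IH1.
  by apply: pabort_PA2; apply: IH2.
Qed.

(** Silent steps are needed exactly where a rule waits for [Skip]: at the end of the first part of a
    sequence, of a resource block, of a critical region, or of both threads. *)
Lemma pstep_erase C s sc h p C' s' h' p' :
  pstep (erase X C) s h p C' s' h' p' -> auxiliary X C -> agree_off s sc ->
  exists C1 sc1, silents h p C sc C1 sc1 /\
  exists C2 sc2, [/\ pstep C1 sc1 h p C2 sc2 h' p', erase X C2 = C',
    auxiliary X C2 & agree_off s' sc2].
Proof.
elim: C p C' p' => [|c|C1 IH1 C2 IH2|B C1 IH1 C2 IH2|B C IH|r C IH|r B C IH|r C IH
  |C1 IH1 C2 IH2] p C' p'.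
- by move=> /= /pstep_skipE.
- move=> H a g; have [E|[E cX]] := erase_basicE erefl a; rewrite E in H.
    by case/pstep_skipE: H.
  have [-> -> Hb] := pstep_basicE H.
  have [sc' Hc gc] := bexec_agree Hb cX g.
  exists (Basic c), sc; split; first exact: silents0.
  by exists Skip, sc'; split=> //; constructor.
- move=> /= /pstep_seqE[[E -> -> -> ->]|[C1' -> H]] [a1 a2] g.
    have [sc1 S] := silents_skip h p sc E.
    exists (Seq Skip C2), sc1; split.
      by apply: (silents_lift (K := fun D => Seq D C2) _ S) => *; exact: silent_seq.
    exists C2, sc1; split=> //; first by constructor.
    by have [_ _ g1] := silents_erase S; move=> x Xx; rewrite g // g1.
  have [D1 [sc1 [S [D2 [sc2 [H' <- a' g']]]]]] := IH1 _ _ _ H a1 g.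
  exists (Seq D1 C2), sc1; split.
    by apply: (silents_lift (K := fun D => Seq D C2) _ S) => *; exact: silent_seq.
  by exists (Seq D2 C2), sc2; split=> //; constructor.
- move=> /= /pstep_ifE[-> -> -> ->] [BX a1 a2] g.
  exists (If B C1 C2), sc; split; first exact: silents0.
  rewrite (beval_agree_off BX g); exists (if beval sc B then C1 else C2), sc.
  split=> //; [|by case: ifP|by case: ifP].
  by case: ifPn => sB; [exact: pstep_IF1|exact: pstep_IF2].
- move=> /= /pstep_whileE[-> -> -> ->] [BX a] g.
  exists (While B C), sc; split; first exact: silents0.
  by exists (If B (Seq C (While B C)) Skip), sc; split=> //; constructor.
- move=> /= /pstep_resourceE[np [[E -> -> -> ->]|[C1 [p1 [-> -> H]]]]] a g.
    have [sc1 S] := silents_skip h (enter r C p) sc E.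
    exists (Resource r Skip), sc1; split; first exact: silents_resource.
    exists Skip, sc1; split=> //; first by constructor.
    by have [_ _ g1] := silents_erase S; move=> x Xx; rewrite g // g1.
  rewrite enter_erase in H.
  have [D1 [sc1 [S [D2 [sc2 [H' <- a' g']]]]]] := IH _ _ _ H a g.
  exists (Resource r D1), sc1; split; first exact: silents_resource.
  exists (Resource r D2), sc2; split=> //; apply: pstep_enter => //.
  have [E _ _] := silents_erase S.
  by rewrite -enter_erase E enter_erase.
- move=> /= /pstep_withE[[-> -> ->] [Dr sB ->]] [BX a] g.
  exists (With r B C), sc; split; first exact: silents0.
  exists (Within r C), sc; split=> //; case: p Dr => O L D Dr; constructor=> //.
  by rewrite -(beval_agree_off BX g).
- move=> /= /pstep_withinE[Or [[E -> -> -> ->]|[C1 [p1 [-> H ->]]]]] a g.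
    have [sc1 S] := silents_skip h (RConf (rO p `\ r) (rL p) (rD p)) sc E.
    exists (Within r Skip), sc1; split.
      by apply: (silents_lift (K := fun D => Within r D) _ S) => *; exact: silent_within.
    exists Skip, sc1; split=> //; first by case: p Or {S} => *; constructor.
    by have [_ _ g1] := silents_erase S; move=> x Xx; rewrite g // g1.
  have [D1 [sc1 [S [D2 [sc2 [H' <- a' g']]]]]] := IH _ _ _ H a g.
  exists (Within r D1), sc1; split.
    by apply: (silents_lift (K := fun D => Within r D) _ S) => *; exact: silent_within.
  exists (Within r D2), sc2; split=> //.
  by case: p Or H' {H S} => O L D Or; case: p1 => *; constructor.
- move=> /= /pstep_parE[[C1' -> H]|[C2' -> H]|[E1 E2 [-> -> -> ->]]] [a1 a2] g.
  + have [D1 [sc1 [S [D2 [sc2 [H' <- a' g']]]]]] := IH1 _ _ _ H a1 g.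
    exists (Par D1 C2), sc1; split.
      by apply: (silents_lift (K := fun D => Par D C2) _ S) => *; exact: silent_parl.
    by exists (Par D2 C2), sc2; split=> //; constructor.
  + have [D1 [sc1 [S [D2 [sc2 [H' <- a' g']]]]]] := IH2 _ _ _ H a2 g.
    exists (Par C1 D1), sc1; split.
      by apply: (silents_lift (K := fun D => Par C1 D) _ S) => *; exact: silent_parr.
    by exists (Par C1 D2), sc2; split=> //; apply: pstep_P2.
  + have [sc1 S1] := silents_skip h p sc E1.
    have [sc2 S2] := silents_skip h p sc1 E2.
    exists (Par Skip Skip), sc2; split.
      apply: (@silents_trans _ _ _ _ (Par Skip C2) sc1).
        by apply: (silents_lift (K := fun D => Par D C2) _ S1) => *; exact: silent_parl.
      by apply: (silents_lift (K := fun D => Par Skip D) _ S2) => *; exact: silent_parr.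
    exists Skip, sc2; split=> //; first by constructor.
    have [_ _ g1] := silents_erase S1; have [_ _ g2] := silents_erase S2.
    by move=> x Xx; rewrite g // g1 // g2.
Qed.

(** Each index promises its own split of the final heap; uniqueness identifies all of them with the
    one found at index 1. *)
Lemma safe_all_step C s h hG p G Q A C' s' k p' : ctx_ok Loc G ->
  (forall m, safe m C s h p G Q A) -> heap_disj h hG ->
  sat s hG (inv_star G (rD p)) ->
  pstep C s (heap_union h hG) p C' s' k p' ->
  exists h' hG', [/\ heap_disj h' hG', k = heap_union h' hG',
    sat s' hG' (inv_star G (rD p')) & forall m, safe m C' s' h' p' G Q A].
Proof.
move=> Gok S d sG H.
have [_ _ _ /(_ _ d sG _ _ _ _ H) [h' [hG' [d' E sG' _]]] _] :=
  (safeS _ _ _ _ _ _ _ Gok).1 (S 1).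
exists h', hG'; split=> // m.
have [_ _ _ /(_ _ d sG _ _ _ _ H) [h1 [hG1 [d1 E1 sG1 S1]]] _] :=
  (safeS _ _ _ _ _ _ _ Gok).1 (S m.+1).
have [<- _] // : h1 = h' /\ hG1 = hG'.
by apply: split_unique Gok d1 d' _ sG1 sG'; rewrite -E1.
Qed.

Lemma inv_star_agree_off G s sc h (D : set Res) : ctx_ok Loc G ->
  X `&` pv_ctx G = set0 -> agree_off s sc ->
  sat s h (inv_star G D) -> sat sc h (inv_star G D).
Proof.
move=> Gok /set0_disj XG g; apply: inv_star_agree => // x Gx.
by apply: g => Xx; exact: XG Gx.
Qed.

(** Auxiliary variables do not occur in the invariants, so [hG] still satisfies them after a silent
    step, and uniqueness of the split shows that the private heap is still [h]. *)
Lemma safe_silents C s h hG p G Q A C1 s1 : ctx_ok Loc G ->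
  X `&` pv_ctx G = set0 -> heap_disj h hG ->
  silents (heap_union h hG) p C s C1 s1 ->
  (forall m, safe m C s h p G Q A) -> sat s hG (inv_star G (rD p)) ->
  (forall m, safe m C1 s1 h p G Q A) /\ sat s1 hG (inv_star G (rD p)).
Proof.
move=> Gok XG d; elim=> // {}C {}s {}C1 {}s1 C2 s2 [H _ _ g] _ IH S sG.
have [h' [hG' [d' E sG' S']]] := safe_all_step Gok S d sG H.
have sG1 := inv_star_agree_off Gok XG g sG.
have [Eh _] := split_unique Gok d d' E sG1 sG'; subst h'.
exact: IH.
Qed.

Lemma safe_erased_post C s sc h hG p G Q A : ctx_ok Loc G ->
  X `&` pv_ctx G = set0 -> X `&` fv_assn Q = set0 -> agree_off s sc ->
  heap_disj h hG -> sat sc hG (inv_star G (rD p)) ->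
  (forall m, safe m C sc h p G Q A) -> erase X C = Skip -> sat s h Q.
Proof.
move=> Gok XG /set0_disj XQ g d sG S E.
have [s1 Sl] := silents_skip (heap_union h hG) p sc E.
have [S1 _] := safe_silents Gok XG d Sl S sG.
have [/(_ erefl) sQ _ _ _ _] := (safeS _ _ _ _ _ _ _ Gok).1 (S1 1).
have [_ _ g1] := silents_erase Sl.
apply: sat_agree sQ => x Qx; rewrite g ?g1 // => Xx; exact: XQ Qx.
Qed.

(* The precondition on [Skip] is needed only initially: afterwards it follows
   from [safe_erased_post], a heap for the available resources being at hand. *)
Lemma safe_erase n C s sc h p G Q A : ctx_ok Loc G ->
  X `&` pv_ctx G = set0 -> X `&` fv_assn Q = set0 ->
  auxiliary X C -> agree_off s sc ->
  (forall m, safe m C sc h p G Q (A `|` X)) ->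
  (erase X C = Skip -> sat s h Q) ->
  safe n (erase X C) s h p G Q A.
Proof.
move=> Gok XG XQ.
have pvX r x : pv G r x -> ~ X x.
  move=> rx Xx; move/set0_disj: XG => /(_ x Xx); apply; exists r => //=.
  by apply: contrapT => nr; move: rx; rewrite pv_none.
elim: n C s sc h p => // n IH C s sc h p a g S sk.
have [_ na ch _ _] := (safeS _ _ _ _ _ _ _ Gok).1 (S 1).
apply/safeS => //; split=> //.
- by move=> /pabort_erase/(_ a g).
- by move=> x r /chng_erase; exact: ch.
- move=> hG d sG C' s' k p' H.
  have [C1 [sc1 [Sl [C2 [sc2 [H' <- a' g']]]]]] := pstep_erase H a g.
  have sGc := inv_star_agree_off Gok XG g sG.
  have [S1 sG1] := safe_silents Gok XG d Sl S sGc.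
  have [h' [hG' [d' -> sG' S']]] := safe_all_step Gok S1 d sG1 H'.
  exists h', hG'; split=> //.
    by apply: inv_star_agree_off sG' => // x Xx; rewrite g'.
  apply: (IH _ _ sc2) => //.
  exact: (safe_erased_post Gok XG XQ g' d' sG' S').
- move=> hG hG' s' p' er d d' sG sG'.
  (* The environment of the erased program may change [X]. The companion store keeps its own values
     there and follows [s'] elsewhere, so the original program sees a legitimate environment
     transition. *)
  pose sc' x := if x \in X then sc x else s' x.
  have g' : agree_off s' sc' by move=> x Xx; rewrite /sc' memNset.
  have S' m : safe m C sc' h p' G Q (A `|` X).
    have [_ _ _ _ en] := (safeS _ _ _ _ _ _ _ Gok).1 (S m.+1).
    apply: (en hG hG') => //; last 2 first.
    + exact: inv_star_agree_off sG.
    + exact: inv_star_agree_off sG'.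
    case: er => ok ok' E EO ELD; split=> // x; rewrite /sc'.
    case: (pselect (X x)) => Xx; first by rewrite mem_set.
    move=> H; rewrite memNset // -g // E // /lockpv locked_erase.
    by case: H => [[]|]; [left| |right].
  apply: (IH _ _ sc') => //.
  have sGc' := inv_star_agree_off Gok XG g' sG'.
  exact: (safe_erased_post Gok XG XQ g' d' sGc' S').
Qed.

Lemma inv_star0 G : inv_star G set0 = AEmp.
Proof.
elim: G => [|d G IH]; first by rewrite /inv_star big_nil.
by rewrite inv_star_cons memNset.
Qed.

Lemma valid_erase n G P C Q A : ctx_ok Loc G -> unextended C ->
  X `&` pv_ctx G = set0 -> X `&` fv_assn Q = set0 -> auxiliary X C ->
  (forall m, valid Loc m G (A `|` X) P C Q) ->
  valid Loc n G A P (erase X C) Q.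
Proof.
move=> Gok u XG XQ a V s h p [ok w Ol dom] sP.
rewrite locked_erase in Ol.
have [wC N] := unextended_wfc u.
apply: (@safe_erase _ _ s s) => //.
  by move=> m; apply: V.
(* With all resources in L the empty heap satisfies the shared invariant, so a pending assignment
   can be executed; this configuration is [good] because [C] locks nothing. *)
pose p0 := RConf set0 (rL p `|` rD p) set0.
have gd0 : good G C p0.
  split=> //.
  - by split; rewrite /= ?set0I ?setI0.
  - by move=> q; split=> // /N.
  - by move=> q; rewrite -dom; move: (Ol q) (N q); setprop; tauto.
apply: (@safe_erased_post C s s h [fmap]%fmap p0 G Q (A `|` X)) => //.
- heaps.
- by rewrite inv_star0.
- by move=> m; apply: V.
Qed.

End Auxiliary.

(** * Induction on derivations *)

Section Soundness.
Context (Var Res : eqType) (Loc : pred nat).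
Implicit Types (C : cmd Var Res) (p : rconf Res) (G : ctx Var Res)
  (P Q R : assn Var) (A X : set Var) (r : Res).

Lemma derivable_wf G A P C Q : derivable Loc G A P C Q -> wf_spec Loc G A P C Q.
Proof. by case. Qed.

Lemma valid_weaken n G A A' P P' C Q Q' :
  entails Loc P' P -> entails Loc Q Q' -> A `<=` A' ->
  valid Loc n G A P C Q -> valid Loc n G A' P' C Q'.
Proof.
move=> PP QQ AA V s h p gd /PP sP.
by apply: (@safe_weaken _ _ _ _ _ _ _ _ G G Q Q' A A') => //; exact: V.
Qed.

Lemma res_ctx_mid G1 d G2 q :
  res_ctx (G1 ++ d :: G2) q <-> res_ctx (d :: G1 ++ G2) q.
Proof.
by rewrite /res_ctx /= !map_cat /= !(inE, mem_cat) orbCA.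
Qed.

Lemma good_mid G1 d G2 C p : good (G1 ++ d :: G2) C p <-> good (d :: G1 ++ G2) C p.
Proof.
split=> -[ok w Ol dom]; split=> // q; rewrite dom; first exact: res_ctx_mid.
by symmetry; exact: res_ctx_mid.
Qed.

Lemma pv_mid G1 d G2 : ctx_ok Loc (G1 ++ d :: G2) ->
  pv (G1 ++ d :: G2) = pv (d :: G1 ++ G2).
Proof.
case=> u _; apply/funext => q; rewrite /pv lookup_mid //.
by move: u; rewrite map_cat cat_uniq /= negb_or => /and3P[_ /andP[]].
Qed.

Lemma valid_mid n G1 d G2 A P C Q : ctx_ok Loc (G1 ++ d :: G2) ->
  valid Loc n (G1 ++ d :: G2) A P C Q <-> valid Loc n (d :: G1 ++ G2) A P C Q.
Proof.
move=> Gok; split=> V s h p gd sP.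
  apply: (@safe_weaken _ _ _ _ _ _ _ _ (G1 ++ d :: G2) _ Q _ A) => //.
  - exact: pv_mid.
  - by move=> *; exact: sat_inv_star_mid.
  - by apply: V => //; apply/good_mid.
apply: (@safe_weaken _ _ _ _ _ _ _ _ (d :: G1 ++ G2) _ Q _ A) => //.
- by rewrite pv_mid.
- by move=> *; symmetry; exact: sat_inv_star_mid.
- by apply: V => //; apply/good_mid.
Qed.

(** All indices are handled in one induction, since loops and auxiliary variables draw on a premise
    at every index. As [C] is unextended, its subcommands start with no resource locked. *)
Theorem derivable_valid G A P C Q : derivable Loc G A P C Q ->
  unextended C -> forall n, valid Loc n G A P C Q.
Proof.
elim=> {G A P C Q} /=.
- move=> G A P [Gok PA _] _ n s h p gd sP.
  by apply: safe_skip => // x Px; apply: PA; left.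
- move=> G A P c Q [Gok PA _] sl cG _ n s h p gd sP.
  apply: safe_basic (sl_sound sl) cG sP => // x ?; apply: PA; first by left.
  by right.
- move=> G A1 A2 P1 P2 P3 C1 C2 [Gok _ _] _ IH1 _ IH2 /andP[u1 u2] n s h p gd sP.
  apply: (@safe_seq _ _ _ _ _ _ _ _ _ _ P2) => //; last by move=> m _; exact: IH2.
  apply: IH1 => //; case: gd => ok [w _] Ol dom; by split.
- move=> G A P C Q R [Gok _ _] _ IH m u n s h p gd [h1 [h2 [d -> sP sR]]].
  apply: safe_frame => //; first by case: gd.
  exact: IH.
- move=> G A P B C [Gok PA _] D IH u n.
  have [_ PBA _] := derivable_wf D.
  apply: valid_while => //.
  + by move=> x Px; apply: PBA; left; left.
  + by move=> x Bx; apply: PBA; left; right.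
  + exact: IH.
- move=> G A1 A2 P1 P2 Q1 Q2 C [Gok _ _] _ IH1 _ IH2 u n s h p gd [sP1 sP2].
  by apply: safe_conj => //; [exact: IH1|exact: IH2].
- move=> G A1 A2 P Q B C1 C2 [Gok PA _] _ IH1 _ IH2 /andP[u1 u2] n.
  apply: valid_if => //.
  + by move=> x Px; apply: PA; left.
  + by move=> m _; exact: IH1.
  + by move=> m _; exact: IH2.
- move=> G A A' P P' Q Q' C _ _ IH PP QQ AA u n.
  by apply: valid_weaken (IH u n).
- move=> G A X P C Q [Gok _ _] _ IH XPQ XG a; rewrite unextended_erase => u n.
  apply: valid_erase => //; last exact: IH.
  by move/set0_disj: XPQ => XPQ; apply/set0_disj => x Xx Qx; apply: (XPQ x) => //; right.
- move=> G A P C Q r r' [Gok _ _] _ + nr' u n.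
  rewrite unextended_ren => /(_ u n).
  rewrite ren_cmd_swap; last by move=> ?; apply: nr'; left.
  rewrite ren_ctx_swap; last by move=> ?; apply: nr'; right.
  exact: valid_map (@swapK _ r r') _ _ _ _ _ _ Gok.
- move=> G A1 A2 P1 P2 Q1 Q2 C1 C2 _ D1 IH1 D2 IH2 m1 m2 /andP[u1 u2] n s h p gd
    [h1 [h2 [d -> sP1 sP2]]].
  have [Gok QA1 _] := derivable_wf D1; have [_ QA2 _] := derivable_wf D2.
  apply: safe_par => //.
  + by move=> x Qx; apply: QA1; right.
  + by move=> x Qx; apply: QA2; right.
  + by apply: IH1 => //; exact: good_hide.
  + by apply: IH2 => //; apply/good_hide/good_parC.
- move=> G1 G2 A X P Q R B C r [Gok PQA _] _ IH u n.
  apply/valid_mid => //; apply: valid_with => //.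
  + exact: ctx_ok_mid.
  + by move=> x Px; apply: PQA; left.
  + by move=> x Qx; apply: PQA; right.
  + exact: IH.
- move=> G1 G2 A X P Q R C r _ D IH u n s h p gd [h1 [h2 [d -> sP sR]]].
  have [Gok PQA _] := derivable_wf D.
  have Gok' := ctx_ok_mid Gok; have [nG _ _ _] := ctx_ok_cons Gok'.
  have [_ N] := unextended_wfc u.
  apply: safe_resource => //.
  + by move=> x Qx; apply: PQA; right.
  (* [r] starts out available, so the heap of [R] is what [held] asks for. *)
  + by rewrite /held asboolF.
  + have /(valid_mid _ _ _ _ _ Gok) V := IH u n.
    by apply: V => //; exact: good_enter.
Qed.

End Soundness.

Theorem theorem3 (Var Res : eqType) (Loc : pred nat)
    (C : cmd Var Res) (P Q : assn Var) (G : ctx Var Res) (A : set Var) :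
  unextended C ->
  ctx_ok Loc G ->
  derivable Loc G A P C Q ->
  forall (s : store Var) (h : heap Loc), sat s h P ->
  forall (n : nat) (L D : set Res),
    L `&` D = set0 -> L `|` D = res_ctx G ->
    safe n C s h (RConf set0 L D) G Q A.
Proof.
move=> u _ D s h sP n L D' LD LDG.
by apply: (derivable_valid D) => //; exact: good_init.
Qed.
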